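(* Let $G\in\mathcal{G}$ be a simple graph, let $\delta=\delta(G)$ and $\widetilde d=\widetilde d(G)$. Then for any two non-negative integers $s$ and $t$, \[ i_{s,t}(G)\le \begin{cases} \ell(G), & \text{if } \delta\le 2 \text{ and } s=t=0;\\ \widetilde d+1+\lceil \log_2 (s+t+1)\rceil, & \text{if } \delta\le 2 \text{ and } s+t\ge 1;\\ 1+\left\lceil\log_2\frac{s+t+1}{\delta-2}\right\rceil, & \text{if } 3\le\delta\le s+t+2;\\ 1, & \text{otherwise}. \end{cases} \]
   Context: Graphs are finite and loopless (parallel edges allowed in general); a simple graph has no parallel edges. $\delta(G)$ is the minimum degree. The line graph $L(G)$ is the simple graph with vertex set $E(G)$ in which two vertices are adjacent iff the corresponding edges of $G$ share an end vertex; $L^0(G)=G$ and $L^i(G)=L(L^{i-1}(G))$. Let $J_1$ (resp. $J_2$) be the graph obtained from $K_{1,3}$ by identifying two (resp. all three) of its degree-1 vertices. $\mathcal{G}$ is the family of connected graphs not isomorphic to a path, a cycle, $K_{1,3}$, $J_1$ or $J_2$. A path is divalent if each of its internal vertices has degree $2$ in $G$; a non-closed divalent path is proper if it is not both of length $2$ and contained in a $K_3$ of $G$. $\ell(G)$ is the maximum length of a proper divalent path of $G$. $\widetilde d(G)=\min\{i:\delta(L^i(G))\ge 3\}$ (this exists for $G\in\mathcal{G}$). For non-negative integers $s,t$, a graph $H$ is $(s,t)$-supereulerian if for any disjoint $X,Y\subset E(H)$ with $|X|\le s$ and $|Y|\le t$, the graph obtained from $H$ by deleting the edges of $Y$ contains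 a spanning closed trail that traverses all edges of $X$. The $(s,t)$-supereulerian index $i_{s,t}(G)$ is the smallest integer $i\ge 0$ such that $L^i(G)$ is $(s,t)$-supereulerian (and $\infty$ if no such $i$ exists). *)

(* Defs.v *)
From HB Require Import structures.
From mathcomp Require Import all_boot all_order all_algebra.
From mathcomp Require Import boolp constructive_ereal reals exp.

Set Implicit Arguments.
Unset Strict Implicit.
Unset Printing Implicit Defensive.

Import Order.TTheory GRing.Theory Num.Theory.

(* Finite loopless graphs, with parallel edges allowed: an edge is an abstract
   object whose set of end vertices has exactly two elements. *)
Record mgraph := MGraph {
  vert : finType;
  edge : finType;
  ends : edge -> {set vert};
  card_ends : forall e, #|ends e| = 2 }.

Arguments ends {G} e : rename.
Arguments card_ends {G} e : rename.

Definition simple_graph (G : mgraph) : Prop := injective (@ends G).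

Definition graph_iso (G H : mgraph) : Prop :=
  exists (f : vert G -> vert H) (g : edge G -> edge H),
    [/\ bijective f, bijective g & forall e, ends (g e) = f @: ends e].

Section Graph.

Variable G : mgraph.

Definition adjacent : rel (vert G) :=
  fun x y => [exists e : edge G, ends e == [set x; y]].

Definition connected_graph : Prop :=
  0 < #|vert G| /\ forall x y, connect adjacent x y.

Definition deg (v : vert G) : nat := #|[set e : edge G | v \in ends e]|.

(* No degree exceeds the number of edges, so the neutral element of the minimum
   is harmless as soon as there is a vertex. *)
Definition min_deg : nat := \big[minn/#|edge G|]_(v : vert G) deg v.

(* A walk is its initial vertex together with the sequence of its steps; a step
   is an edge paired with the vertex it leads to. *)
Fixpoint walk (x : vert G) (p : seq (edge G * vert G)) : bool :=
  if p is (e, y) :: p' then (ends e == [set x; y]) && walk y p' else true.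

Definition walk_edges (p : seq (edge G * vert G)) : seq (edge G) := unzip1 p.

Definition walk_verts (x : vert G) (p : seq (edge G * vert G)) : seq (vert G) :=
  x :: unzip2 p.

Definition internal_verts (x : vert G) (p : seq (edge G * vert G)) :=
  behead (belast x (unzip2 p)).

Definition closed_trail (x : vert G) (p : seq (edge G * vert G)) : bool :=
  [&& walk x p, uniq (walk_edges p) & last x (unzip2 p) == x].

Definition spanning (x : vert G) (p : seq (edge G * vert G)) : bool :=
  [forall v, v \in walk_verts x p].

(* All the vertices, including the two ends, are distinct: the path is not
   closed. *)
Definition open_path (x : vert G) (p : seq (edge G * vert G)) : bool :=
  walk x p && uniq (walk_verts x p).

Definition divalent (x : vert G) (p : seq (edge G * vert G)) : bool :=
  all (fun v => deg v == 2) (internal_verts x p).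

Definition in_K3 (p : seq (edge G * vert G)) : bool :=
  [exists a : vert G, exists b : vert G, exists c : vert G,
   exists e1 : edge G, exists e2 : edge G, exists e3 : edge G,
    [&& uniq [:: a; b; c], ends e1 == [set a; b], ends e2 == [set b; c],
        ends e3 == [set a; c]
      & all (fun e => e \in [:: e1; e2; e3]) (walk_edges p)]].

Definition proper_divalent_path (x : vert G) (p : seq (edge G * vert G)) : bool :=
  [&& open_path x p, divalent x p & ~~ ((size p == 2) && in_K3 p)].

(* A path of length n has n + 1 distinct vertices, whence the bound on n. *)
Definition ell : nat :=
  \max_(n < #|vert G| |
        [exists x : vert G, exists p : n.-tuple (edge G * vert G),
          proper_divalent_path x p]) n.

(* Edges of the line graph: pairs of distinct edges of G sharing an end. *)
Definition line_adj (A : {set edge G}) : bool :=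
  [exists e : edge G, exists f : edge G,
    [&& e != f, ends e :&: ends f != set0 & A == [set e; f]]].

Lemma line_card (A : {A : {set edge G} | line_adj A}) : #|val A| = 2.
Proof.
by case: A => A /= /existsP[e /existsP[f /and3P[ef _ /eqP ->]]]; rewrite cards2 ef.
Qed.

Definition line_graph : mgraph := MGraph line_card.

Lemma del_card (Y : {set edge G}) (e : {e : edge G | e \notin Y}) :
  #|ends (val e)| = 2.
Proof. exact: card_ends. Qed.

Definition del_edges (Y : {set edge G}) : mgraph := MGraph (@del_card Y).

End Graph.

Definition iter_line (i : nat) (G : mgraph) : mgraph := iter i line_graph G.

Definition supereulerian (s t : nat) (H : mgraph) : Prop :=
  forall X Y : {set edge H},
    [disjoint X & Y] -> #|X| <= s -> #|Y| <= t ->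
    exists (x : vert (del_edges Y))
           (p : seq (edge (del_edges Y) * vert (del_edges Y))),
      [/\ closed_trail x p, spanning x p
        & forall e, e \in X -> e \in [seq val f | f <- walk_edges p]].

Definition least (P : nat -> Prop) : option nat :=
  if pselect (exists n, `[< P n >]) is left exP then Some (ex_minn exP) else None.

(* The default value is never used on the graphs of the family below. *)
Definition d_tilde (G : mgraph) : nat :=
  odflt 0 (least (fun i => 3 <= min_deg (iter_line i G))).

Definition st_index (s t : nat) (G : mgraph) : \bar int :=
  if least (fun i => supereulerian s t (iter_line i G)) is Some i
  then (i%:Z)%:E else +oo%E.

Lemma path_card n (i : 'I_n) : #|[set widen_ord (leqnSn n) i; lift ord0 i]| = 2.
Proof. by rewrite cards2 -val_eqE /= /bump /= add1n neq_ltn ltnSn. Qed.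

(* The path of length n; length 0 gives the one-vertex graph. *)
Definition path_graph (n : nat) : mgraph := MGraph (@path_card n).

Lemma cycle_card n (i : 'I_n.+2) : #|[set i; ordS i]| = 2.
Proof.
rewrite cards2 -val_eqE /=; case: (ltnP i n.+1) => [lt_in|le_ni].
  by rewrite modn_small // neq_ltn ltnSn.
have -> : val i = n.+1 by apply/eqP; rewrite eqn_leq le_ni -ltnS ltn_ord.
by rewrite modnn.
Qed.

(* The cycle of length n + 2; length 2 is a pair of parallel edges. *)
Definition cycle_graph (n : nat) : mgraph := MGraph (@cycle_card n).

Lemma star_card k (f : 'I_3 -> 'I_k) (e : 'I_3) :
  #|[set None; Some (f e)]| = 2.
Proof. by rewrite cards2. Qed.

(* K_{1,3} has centre None and leaves Some i; two leaves are identified when f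
   sends them to the same element (f is meant to be onto). *)
Definition star_quotient k (f : 'I_3 -> 'I_k) : mgraph := MGraph (star_card f).

Definition K13 : mgraph := star_quotient (id : 'I_3 -> 'I_3).

Definition J1 : mgraph :=
  star_quotient (fun i : 'I_3 => if i == ord_max then ord_max else ord0 : 'I_2).

Definition J2 : mgraph := star_quotient (fun _ : 'I_3 => ord0 : 'I_1).

Definition in_family (G : mgraph) : Prop :=
  [/\ connected_graph G,
      forall n, ~ graph_iso G (path_graph n),
      forall n, ~ graph_iso G (cycle_graph n)
    & [/\ ~ graph_iso G K13, ~ graph_iso G J1 & ~ graph_iso G J2]].

Definition ceil_log2 (R : realType) (x : R) : int := Num.ceil (ln x / ln 2)%R.

(* Main.v *)
Require Import Defs.
From mathcomp Require Import all_boot all_order all_algebra.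
From mathcomp Require Import boolp constructive_ereal reals exp.
From mathcomp Require Import zify.

Set Implicit Arguments.
Unset Strict Implicit.
Unset Printing Implicit Defensive.

Import Order.TTheory GRing.Theory Num.Theory.

(** Call a graph collapsible (Catlin) when every even vertex set is the set of
    odd vertices of a connected spanning subgraph; overlapping collapsible parts
    merge.  If H - (X u Y) is collapsible, a connected spanning subgraph whose odd
    vertices are those of X becomes, together with X, an Eulerian subgraph of
    H - Y containing X.

    In L(G) every vertex v of G gives a clique on d(v) vertices, and a clique on d
    vertices stays collapsible after the loss of any d - 3 edges, so L(G) is
    (s,t)-supereulerian as soon as delta(G) >= s + t + 3.  Since
    delta(L(G)) - 2 >= 2 (delta(G) - 2), this yields all the logarithmic bounds.

    For s = t = 0, when every divalent path of length 2 outside the triangles is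
    bypassed by a path through vertices of degree at least 3, the cliques of those
    vertices merge and absorb all of L(G).  The same condition on divalent paths of
    length n + 1 in G gives the one for n in L(G); it holds vacuously for
    n = ell(G) + 1, so L^i(G) has it for n = 2 when i = ell(G) - 1, and three line
    graphs later the minimum degree is at least 3. *)

(** * Incidence, adjacency and degrees *)

Section Incidence.

Variable G : mgraph.
Implicit Types (x y u v : vert G) (e f g : edge G).

Lemma endsP v e : v \in ends e -> exists2 u, v != u & ends e = [set v; u].
Proof.
move=> ve; have /cards2P[a [b [ab eE]]] : #|ends e| == 2 by rewrite card_ends.
move: ve; rewrite eE !inE => /orP[]/eqP->; first by exists b.
by exists a; [rewrite eq_sym | rewrite setUC].
Qed.

Lemma ends_pair e : exists x y, x != y /\ ends e = [set x; y].
Proof.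
have /cards2P[a [b [ab eE]]] : #|ends e| == 2 by rewrite card_ends.
by exists a, b.
Qed.

Lemma ends_neq e x y : ends e = [set x; y] -> x != y.
Proof. by move=> eE; have := card_ends e; rewrite eE cards2; case: (x != y). Qed.

Lemma set2_other (x y v : vert G) :
  [set x; y] = [set x; v] -> x != y -> y = v.
Proof.
move=> E xy; have : y \in [set x; v] by rewrite -E set22.
by rewrite !inE eq_sym (negbTE xy) => /eqP.
Qed.

Lemma adjacentP x y : reflect (exists e, ends e = [set x; y]) (adjacent x y).
Proof. by apply: (iffP existsP) => -[e] /eqP; exists e => //; apply/eqP. Qed.

Lemma adjacent_sym : symmetric (@adjacent G).
Proof. by move=> x y; rewrite /adjacent setUC. Qed.

Lemma adjacent_neq x y : adjacent x y -> x != y.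
Proof. by case/adjacentP=> e /ends_neq. Qed.

Lemma deg_adjacent x y : adjacent x y -> 0 < deg x.
Proof.
by case/adjacentP=> e eE; apply/card_gt0P; exists e; rewrite inE eE set21.
Qed.

Hypothesis simpG : simple_graph G.

Lemma simple_edge_eq x y e f : x != y -> x \in ends e -> y \in ends e ->
  x \in ends f -> y \in ends f -> e = f.
Proof.
move=> xy xe ye xf yf; apply: simpG.
have [u _ eE] := endsP xe; have [w _ fE] := endsP xf.
move: ye yf; rewrite eE fE !inE !(eq_sym y) (negbTE xy) /= ![_ == y]eq_sym.
by move=> /eqP-> /eqP->.
Qed.

Lemma deg_neighbours x : deg x = #|[set y | adjacent x y]|.
Proof.
rewrite /deg -(card_imset _ simpG).
rewrite -(card_in_imset (f := fun y => [set x; y]) (D := [set y | adjacent x y])).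
  apply: eq_card => A; apply/imsetP/imsetP => -[].
    move=> e; rewrite inE => xe ->; have [y _ eE] := endsP xe.
    by exists y => //; rewrite inE; apply/adjacentP; exists e.
  move=> y; rewrite inE => /adjacentP[e eE] ->; exists e => //.
  by rewrite inE eE set21.
move=> y z; rewrite !inE => /adjacent_neq xy _ /set2_other; exact.
Qed.

Lemma deg2_edges v e f g : deg v = 2 -> e != f ->
  v \in ends e -> v \in ends f -> v \in ends g -> (g == e) || (g == f).
Proof.
move=> d2 ef ve vf vg.
have /eqP E : [set e; f] == [set h : edge G | v \in ends h].
  rewrite eqEcard cards2 ef; move: d2; rewrite /deg => ->; rewrite leqnn andbT.
  by apply/subsetP => h; rewrite !inE => /orP[]/eqP->.
by rewrite -in_set2 E inE.
Qed.

Lemma deg2_neighbours v x y z : deg v = 2 -> x != y ->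
  adjacent v x -> adjacent v y -> adjacent v z -> (z == x) || (z == y).
Proof.
rewrite deg_neighbours => d2 xy vx vy vz.
have /eqP E : [set x; y] == [set h | adjacent v h].
  rewrite eqEcard cards2 xy d2 andbT.
  by apply/subsetP => h; rewrite !inE => /orP[]/eqP->.
by rewrite -in_set2 E inE.
Qed.

Lemma deg_gt1P v : reflect (exists x y, [/\ x != y, adjacent v x & adjacent v y])
  (1 < deg v).
Proof.
rewrite deg_neighbours; apply: (iffP card_gt1P) => -[x [y []]].
  by rewrite !inE => vx vy xy; exists x, y.
by move=> xy vx vy; exists x, y; rewrite !inE.
Qed.

Lemma another_neighbour v x : 1 < deg v -> exists2 y, adjacent v y & y != x.
Proof.
case/deg_gt1P=> y [z [yz vy vz]]; have [yx|] := eqVneq y x; last by exists y.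
by exists z; rewrite // -yx eq_sym.
Qed.

Lemma three_neighbours v x y z : uniq [:: x; y; z] ->
  adjacent v x -> adjacent v y -> adjacent v z -> 2 < deg v.
Proof.
move=> U vx vy vz; have /= <- := card_uniqP U; rewrite deg_neighbours.
apply: subset_leq_card; apply/subsetP => h.
by rewrite !inE => /or3P[]/eqP->.
Qed.

Lemma three_edges v e f g : uniq [:: e; f; g] ->
  v \in ends e -> v \in ends f -> v \in ends g -> 2 < deg v.
Proof.
move=> U ve vf vg; have /= <- := card_uniqP U.
apply: subset_leq_card; apply/subsetP => h.
by rewrite !inE => /or3P[]/eqP->.
Qed.

End Incidence.

(** * Adjacency and degrees in the line graph *)

Section LineGraph.

Variable G : mgraph.
Implicit Types (x y u v : vert G) (e f g : edge G).

Lemma line_simple : simple_graph (line_graph G).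
Proof. exact: val_inj. Qed.

Lemma line_adjacentP (e f : edge G) :
  reflect (e != f /\ exists v, v \in ends e /\ v \in ends f)
          (@adjacent (line_graph G) e f).
Proof.
apply: (iffP idP) => [/adjacentP[[A LA]] /= AE|[ef [v [ve vf]]]].
  have ef : e != f by have := line_card (exist _ A LA); rewrite /= AE cards2; case: (e != f).
  split=> //; have /existsP[e' /existsP[f' /and3P[ef' /set0Pn[v]]]] := LA.
  rewrite inE => /andP[ve vf] /eqP; rewrite AE => E.
  have he : e \in [set e'; f'] by rewrite -E set21.
  have hf : f \in [set e'; f'] by rewrite -E set22.
  move: he hf ef; rewrite !inE => /orP[]/eqP-> /orP[]/eqP->; rewrite ?eqxx // => _;
  by exists v.
have L : line_adj [set e; f].
  apply/existsP; exists e; apply/existsP; exists f; rewrite ef eqxx andbT /=.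
  by apply/set0Pn; exists v; rewrite inE ve.
by apply/adjacentP; exists (exist (fun A => line_adj A) _ L).
Qed.

Lemma line_adjacentI v e f : e != f -> v \in ends e -> v \in ends f ->
  @adjacent (line_graph G) e f.
Proof. by move=> ef ve vf; apply/line_adjacentP; split=> //; exists v. Qed.

Hypothesis simpG : simple_graph G.

(** In a simple graph the edges at [u] and those at [v] have only [e] in common, and together they
    are [e] and its neighbours in the line graph. *)
Lemma line_deg e u v : ends e = [set u; v] ->
  (@deg (line_graph G) e + 2 = deg u + deg v)%N.
Proof.
move=> eE; have uv := ends_neq eE.
rewrite (deg_neighbours line_simple).
pose I w := [set f : edge G | w \in ends f].
have eu : e \in I u by rewrite inE eE set21.
have ev : e \in I v by rewrite inE eE set22.
have UE : I u :|: I v = e |: [set f | @adjacent (line_graph G) e f].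
  apply/setP => f; rewrite !inE; apply/idP/idP.
    case: (eqVneq f e) => //= fe; rewrite eq_sym in fe.
    by case/orP; apply: line_adjacentI; rewrite // eE ?set21 ?set22.
  case/orP=> [/eqP->|/line_adjacentP[_ [w []]]]; first by rewrite eE set21.
  by rewrite eE !inE => /orP[]/eqP-> ->; rewrite ?orbT.
have IE : I u :&: I v = [set e].
  apply/setP => f; rewrite !inE; apply/andP/eqP => [[uf vf]|->].
    by apply: (simple_edge_eq simpG uv) uf vf _ _; rewrite eE ?set21 ?set22.
  by rewrite eE set21 set22.
have := cardsUI (I u) (I v); rewrite UE IE cards1 cardsU1.
rewrite inE; have -> : @adjacent (line_graph G) e e = false.
  by apply/negbTE/negP => /adjacent_neq; rewrite eqxx.
rewrite /deg /I /=; lia.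
Qed.

End LineGraph.

(** * Walks inside a set of vertices *)

Definition within (G : mgraph) (M : pred (vert G)) : rel (vert G) :=
  [rel x y | [&& adjacent x y, M x & M y]].

Lemma within_connect_sym (G : mgraph) (M : pred (vert G)) :
  connect_sym (within M).
Proof.
by apply: sym_connect_sym => x y; rewrite /within /= adjacent_sym (andbC (M x)).
Qed.

(** The empty walk says nothing about [M], but every step of [within M] has both ends in [M]. This
    is how a bypass shows that its ends are branching. *)
Lemma within_connect_neq (G : mgraph) (M : pred (vert G)) x y :
  connect (within M) x y -> x != y -> M x /\ M y.
Proof.
move=> c xy; split.
  case/connectP: c xy => -[|z p] /=; first by move=> _ ->; rewrite eqxx.
  by case/andP=> /and3P[].
move: c; rewrite within_connect_sym.
case/connectP => -[|z p] /=; first by move=> _ xE; rewrite xE eqxx in xy.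
by case/andP=> /and3P[].
Qed.

(* A walk inside [M] from an end of [e] to an end of [f] gives, edge by edge, a
   walk from [e] to [f] in the line graph. *)
Lemma line_connect (G : mgraph) (M : pred (vert G)) (N : pred (edge G)) :
  (forall g x y, ends g = [set x; y] -> M x -> M y -> N g) ->
  forall x y e f, connect (within M) x y -> x \in ends e -> y \in ends f ->
  N e -> N f -> connect (@within (line_graph G) N) e f.
Proof.
move=> MN x y e f /connectP[p]; elim: p x e => [|z p IH] x e /=.
  move=> _ <- xe xf Ne Nf; have [->|ef] := eqVneq e f; first exact: connect0.
  by apply: connect1; rewrite /within /= Ne Nf !andbT; apply: line_adjacentI xe xf.
case/andP=> /and3P[/adjacentP[g gE] Mx Mz] zp yE xe yf Ne Nf.
have Ng : N g by apply: MN gE _ _.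
have zg : z \in ends g by rewrite gE set22.
apply: connect_trans (IH z g zp yE zg yf Ng Nf).
have [->|eg] := eqVneq e g; first exact: connect0.
apply: connect1; rewrite /within /= Ne Ng !andbT; apply: line_adjacentI eg xe _.
by rewrite gE set21.
Qed.

Lemma connected_closed (G : mgraph) (P : vert G -> Prop) x :
  connected_graph G -> P x ->
  (forall u v, P u -> adjacent u v -> P v) -> forall y, P y.
Proof.
move=> [_ C] Px cl y; have /connectP[p] := C x y.
elim: p x Px {C} => [|z p IH] x Px /=; first by move=> _ ->.
by case/andP=> xz zp; apply: IH (cl _ _ Px xz) zp.
Qed.

Lemma within_predT (G : mgraph) : @within G predT =2 @adjacent G.
Proof. by move=> x y; rewrite /within /= !andbT. Qed.

Lemma line_connected (G : mgraph) (e : edge G) :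
  connected_graph G -> connected_graph (line_graph G).
Proof.
move=> [_ C]; split=> [|f g]; first by apply/card_gt0P; exists e.
have [x [x' [_ fE]]] := ends_pair f; have [y [y' [_ gE]]] := ends_pair g.
rewrite -(eq_connect (@within_predT (line_graph G))).
by apply: (@line_connect G predT predT _ x y) => //;
  rewrite ?fE ?gE ?set21 // (eq_connect (@within_predT G)).
Qed.

Definition branching (G : mgraph) : pred (vert G) := fun v => 2 < deg v.

(** * Collapsible subgraphs and Eulerian trails *)

Lemma odd_card_xor (T : finType) (P Q : pred T) :
  odd #|[set v | P v (+) Q v]| = odd #|[set v | P v]| (+) odd #|[set v | Q v]|.
Proof.
have E (A : {set T}) : odd #|A| = \big[addb/false]_(v : T) (v \in A).
  rewrite -sum1_card big_mkcond /=.
  apply: (big_rec2 (fun n b => odd n = b)) => // v n b _ <-.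
  by rewrite oddD; case: (v \in A).
by rewrite !E -big_split /=; apply: eq_bigr => v _; rewrite !inE.
Qed.

Section Parity.

Variable G : mgraph.
Implicit Types (x y u v : vert G) (e f g : edge G) (D : {set edge G}).

(** The boundary of [D] modulo 2, hence additive on disjoint unions. *)
Definition parity D v : bool := odd #|[set e in D | v \in ends e]|.

Lemma parity0 v : parity set0 v = false.
Proof.
have E : [set e in set0 | v \in ends e] = set0 by apply/setP => e; rewrite !inE.
by rewrite /parity E cards0.
Qed.

Lemma parityU D D' v : [disjoint D & D'] ->
  parity (D :|: D') v = parity D v (+) parity D' v.
Proof.
move=> dis; pose I (A : {set edge G}) := [set e in A | v \in ends e].
rewrite /parity -oddD -cardsUI -/(I D) -/(I D') -/(I _).
have -> : I D :&: I D' = set0; last first.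
  rewrite cards0 addn0; congr (odd #|pred_of_set _|).
  by apply/setP => e; rewrite !inE andb_orl.
apply/setP => e; rewrite !inE; apply/negP => /andP[/andP[De _] /andP[D'e _]].
by rewrite (disjointFr dis De) in D'e.
Qed.

Lemma parity1 e v : parity [set e] v = (v \in ends e).
Proof.
rewrite /parity; case: (boolP (v \in ends e)) => ve.
  have -> : [set f in [set e] | v \in ends f] = [set e]; last by rewrite cards1.
  by apply/setP => f; rewrite !inE; case: eqP => // ->.
have -> : [set f in [set e] | v \in ends f] = set0; last by rewrite cards0.
by apply/setP => f; rewrite !inE; case: eqP => // ->; rewrite (negbTE ve).
Qed.

Lemma parityU1 e D v : e \notin D ->
  parity (e |: D) v = (v \in ends e) (+) parity D v.
Proof. by move=> eD; rewrite parityU ?parity1 // disjoints1. Qed.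

Lemma parityD D D' v : D' \subset D ->
  parity (D :\: D') v = parity D v (+) parity D' v.
Proof.
move=> sub; have /setIidPr E := sub.
rewrite -[D in RHS](setID D D') E setUC parityU ?addbK //.
by rewrite disjoint_sym -setI_eq0 setIDA setDIl setDv set0I.
Qed.

(** Removing one edge flips the parity at exactly its two ends; induction on [#|D|]. *)
Lemma handshake D : ~~ odd #|[set v | parity D v]|.
Proof.
have [n] := ubnP #|D|; elim: n D => // n IH D; rewrite ltnS => Dn.
have [->|[e eD]] := set_0Vmem D.
  have -> : [set v | parity set0 v] = set0; last by rewrite cards0.
  by apply/setP => v; rewrite !inE parity0.
have -> : [set v | parity D v] = [set v | (v \in ends e) (+) parity (D :\ e) v].
  by apply/setP => v; rewrite !inE -[D in LHS](setD1K eD) parityU1 // setD11.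
rewrite odd_card_xor (negbTE (IH _ _)) ?addbF; last first.
  by move: Dn; rewrite (cardsD1 e) eD.
by have -> : [set v in ends e] = ends e; [apply/setP => v; rewrite inE | rewrite card_ends].
Qed.

Definition joins D : rel (vert G) := [rel x y | [exists e in D, ends e == [set x; y]]].

Lemma joinsI D e x y : e \in D -> ends e = [set x; y] -> joins D x y.
Proof. by move=> eD eE; apply/existsP; exists e; rewrite eD eE /=. Qed.

Lemma joinsS D D' : D \subset D' -> subrel (joins D) (joins D').
Proof.
move=> /subsetP sub x y /existsP[e /andP[/sub eD eE]].
by apply/existsP; exists e; rewrite eD.
Qed.

Lemma joins_connect_sym D : connect_sym (joins D).
Proof. by apply: sym_connect_sym => x y; rewrite /joins /= setUC. Qed.

Lemma joins_connectS D D' : D \subset D' ->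
  subrel (connect (joins D)) (connect (joins D')).
Proof. by move=> sub; apply: connect_sub => x y /(joinsS sub)/connect1. Qed.

End Parity.

(** * Closed Eulerian trails *)

Section Euler.

Variable G : mgraph.
Implicit Types (x y z u v : vert G) (e f g : edge G) (D : {set edge G}).
Implicit Types (p q : seq (edge G * vert G)).

Definition trail_in D x p :=
  [&& walk x p, uniq (walk_edges p) & all (mem D) (walk_edges p)].

Lemma walk_cat x p q : walk x (p ++ q) = walk x p && walk (last x (unzip2 p)) q.
Proof. by elim: p x => //= -[e y] p IH x; rewrite IH andbA. Qed.

Lemma walk_edges_cat p q : walk_edges (p ++ q) = walk_edges p ++ walk_edges q.
Proof. exact: map_cat. Qed.

Lemma walk_split x p z : z \in walk_verts x p ->
  exists p1 p2, p = p1 ++ p2 /\ last x (unzip2 p1) = z.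
Proof.
elim: p x => [|[e y] p IH] x; rewrite /walk_verts /= in_cons.
  by rewrite in_nil orbF => /eqP->; exists [::], [::].
case: eqVneq => [->|_] /=; first by exists [::], ((e, y) :: p).
by case/IH=> p1 [p2 [-> <-]]; exists ((e, y) :: p1), p2.
Qed.

Lemma walk_edge_ends x p e v : walk x p -> e \in walk_edges p -> v \in ends e ->
  v \in walk_verts x p.
Proof.
elim: p x => [|[f y] p IH] x //=; rewrite in_cons => /andP[/eqP fE w].
case/orP=> [/eqP->|ep ve].
  rewrite fE /walk_verts /= !inE => /orP[]->; by rewrite ?orbT.
by rewrite /walk_verts in_cons (IH y) ?orbT.
Qed.

Lemma trail_parity x p v : walk x p -> uniq (walk_edges p) ->
  parity [set e in walk_edges p] v = (v == x) (+) (v == last x (unzip2 p)).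
Proof.
elim: p x => [|[e y] p IH] x /=.
  move=> _ _; rewrite addbb -[RHS](parity0 v).
  by congr parity; apply/setP => e; rewrite !inE.
case/andP=> /eqP eE w /andP[ep U]; rewrite set_cons parityU1 ?inE //.
rewrite (IH y) // eE !inE addbA; congr addb.
have := ends_neq eE; case: (eqVneq v x) => [->|_] /=; last by case: (v == y).
by case: eqVneq.
Qed.

Lemma trail_size D x p : trail_in D x p -> size p <= #|D|.
Proof.
case/and3P=> _ U /allP sub; rewrite cardE -(size_map fst).
by apply: uniq_leq_size => // e /sub /=; rewrite mem_enum.
Qed.

(* A trail of an even set that is not closed can be extended, since it uses an
   odd number of the edges at its last vertex. *)
Lemma trail_close D x p : (forall v, parity D v = false) -> trail_in D x p ->
  exists q, trail_in D x (p ++ q) /\ last x (unzip2 (p ++ q)) = x.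
Proof.
move=> even; have [n] := ubnP (#|D| - size p); elim: n p => // n IH p len tp.
case: (eqVneq (last x (unzip2 p)) x) => [E|ne]; first by exists [::]; rewrite cats0.
have /and3P[w U A] := tp.
have sub : [set e in walk_edges p] \subset D.
  by apply/subsetP => e; rewrite inE => /(allP A).
have : parity (D :\: [set e in walk_edges p]) (last x (unzip2 p)).
  by rewrite parityD // even (trail_parity _ w U) eqxx (negbTE ne).
rewrite /parity => /odd_gt0/card_gt0P[e]; rewrite !inE => /andP[/andP[ep eD] le].
have [y _ eE] := endsP le.
have tp' : trail_in D x (rcons p (e, y)).
  rewrite -cats1 /trail_in walk_cat walk_edges_cat w /= eE eqxx /=.
  by rewrite cats1 rcons_uniq ep U all_rcons /= eD A.
have [|q [tq lq]] := IH (rcons p (e, y)) _ tp'.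
  by have := trail_size tp'; rewrite size_rcons; lia.
by exists ((e, y) :: q); rewrite -cat_rcons.
Qed.

Lemma closed_trail_grow D x p : (forall v, parity D v = false) ->
  (forall u v, connect (joins D) u v) -> trail_in D x p ->
  last x (unzip2 p) = x -> (exists2 e, e \in D & e \notin walk_edges p) ->
  exists p', [/\ trail_in D x p', last x (unzip2 p') = x & size p < size p'].
Proof.
move=> even con tp lp [e0 e0D e0p]; have /and3P[w U A] := tp.
have sub : [set e in walk_edges p] \subset D.
  by apply/subsetP => e; rewrite inE => /(allP A).
have [z zp [e [eD ep ze]]] : exists2 z, z \in walk_verts x p &
    exists e, [/\ e \in D, e \notin walk_edges p & z \in ends e].
  apply: contrapT => no.
  have cl u v : u \in walk_verts x p -> joins D u v -> v \in walk_verts x p.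
    move=> up /existsP[e /andP[eD /eqP eE]]; have [ep|ep] := boolP (e \in walk_edges p).
      by apply: walk_edge_ends w ep _; rewrite eE set22.
    by case: no; exists u => //; exists e; rewrite eE set21.
  have all v : v \in walk_verts x p.
    have /connectP[r] := con x v; have : x \in walk_verts x p by rewrite mem_head.
    elim: r {1 3 4}x => [|y r IH] u up /=; first by move=> _ ->.
    by case/andP=> /(cl _ _ up); apply: IH.
  have [a [b [_ e0E]]] := ends_pair e0; apply: no.
  by exists a => //; exists e0; rewrite e0E set21.
have [y _ eE] := endsP ze.
set D' := D :\: [set e in walk_edges p].
have even' v : parity D' v = false.
  by rewrite parityD // even (trail_parity _ w U) lp addbb.
have [|q [tq lq]] := @trail_close D' z [:: (e, y)] even'.
  by rewrite /trail_in /= eE eqxx !inE eD ep.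
rewrite cat1s in tq lq; have /and3P[wq Uq Aq] := tq.
have [p1 [p2 [pE p1z]]] := walk_split zp.
exists (p1 ++ ((e, y) :: q) ++ p2); split; last by rewrite pE !size_cat /=; lia.
  have Ep : perm_eq (walk_edges (p1 ++ ((e, y) :: q) ++ p2))
                    (walk_edges ((e, y) :: q) ++ walk_edges p).
    by rewrite pE !walk_edges_cat perm_catCA.
  apply/and3P; split.
  - move: w; rewrite pE !walk_cat p1z lq => /andP[-> ->].
    by rewrite wq.
  - rewrite (perm_uniq Ep) cat_uniq Uq U andbT /=; apply/hasPn => f fp.
    by apply/negP => /(allP Aq); rewrite !inE fp.
  - rewrite (perm_all _ Ep) all_cat A andbT; apply/allP => f /(allP Aq).
    by rewrite !inE => /andP[].
move: lp; rewrite pE /unzip2 !map_cat !last_cat -!/(unzip2 _) p1z lq //.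
Qed.

(** A closed trail in [D] that cannot grow uses all of [D], and growth stops because lengths are at
    most [#|D|]. Each vertex other than [x] has an edge of [D], since [D] connects it to [x], and is
    therefore visited. *)
Lemma euler D x : (forall v, parity D v = false) ->
  (forall u v, connect (joins D) u v) ->
  exists p, [/\ closed_trail x p, spanning x p & walk_edges p =i D].
Proof.
move=> even con.
have [p [tp lp full]] : exists p, [/\ trail_in D x p, last x (unzip2 p) = x &
    {subset D <= walk_edges p}].
  suff H n p : #|D| - size p < n -> trail_in D x p -> last x (unzip2 p) = x ->
      exists p, [/\ trail_in D x p, last x (unzip2 p) = x & {subset D <= walk_edges p}].
    exact: (H _ [::] (ltnSn _)).
  elim: n p => // n IH p len tp lp.
  have [/subsetP sub|/subsetPn[e eD ep]] :=
    boolP (D \subset [set e in walk_edges p]).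
    by exists p; split => // e /sub; rewrite inE.
  have [|p' [tp' lp' sz]] := closed_trail_grow even con tp lp.
    by exists e => //; rewrite inE in ep.
  by apply: (IH p') => //; have := trail_size tp'; lia.
have /and3P[w U A] := tp; exists p; split.
- by rewrite /closed_trail w U lp eqxx.
- apply/forallP => v; have /connectP[[|y r]] := con v x.
    by move=> _ /= <-; rewrite /walk_verts mem_head.
  case/andP=> /existsP[e /andP[eD /eqP eE]] _ _.
  by apply: walk_edge_ends w (full e eD) _; rewrite eE set21.
- by move=> e; apply/idP/idP => [/(allP A)|/full].
Qed.

Lemma walk_lift (Y : {set edge G}) x p : walk x p ->
  all (fun e => e \notin Y) (walk_edges p) ->
  exists p' : seq (edge (del_edges Y) * vert (del_edges Y)),
    [/\ @walk (del_edges Y) x p', map val (walk_edges p') = walk_edges p &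
        unzip2 p' = unzip2 p].
Proof.
elim: p x => [|[e y] p IH] x /=; first by exists [::].
case/andP=> eE w /andP[eY A]; have [p' [w' E1 E2]] := IH y w A.
exists ((exist (fun e => e \notin Y) e eY, y) :: p').
by rewrite /= eE w' E1 E2.
Qed.

End Euler.

(** * Collapsible vertex sets *)

Section Collapsible.

Variable G : mgraph.
Implicit Types (x y z u v : vert G) (e f g : edge G) (D E : {set edge G}).
Implicit Types (S T : {set vert G}).

Definition inside S : {set edge G} := [set e | ends e \subset S].

(* Catlin's notion, for the subgraph induced by [S] in the spanning subgraph
   with edge set [E]. *)
Definition collapsible E S := forall T, T \subset S -> ~~ odd #|T| ->
  exists D, [/\ D \subset E :&: inside S, forall v, parity D v = (v \in T) &
    {in S &, forall x y, connect (joins D) x y}].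

Lemma parity_outside D S v : D \subset inside S -> v \notin S -> parity D v = false.
Proof.
move=> /subsetP sub vS; rewrite /parity.
have -> : [set e in D | v \in ends e] = set0; last by rewrite cards0.
apply/setP => e; rewrite !inE; apply/negP => /andP[/sub].
by rewrite inE => /subsetP eS /eS; rewrite (negbTE vS).
Qed.

Lemma insideS S S' : S \subset S' -> inside S \subset inside S'.
Proof. by move=> sub; apply/subsetP => e; rewrite !inE => /subset_trans; apply. Qed.

Lemma collapsible1 E v : collapsible E [set v].
Proof.
move=> T sub even; exists set0; split; rewrite ?sub0set //.
  move=> w; rewrite parity0; move: sub even; rewrite subset1 => /orP[]/eqP->.
    by rewrite cards1.
  by rewrite inE.
by move=> x y /set1P-> /set1P->; apply: connect0.
Qed.

(* The contraction principle: a collapsible part may be treated as one vertex. *)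
Lemma collapsible_extend E S S' : collapsible E S -> S \subset S' ->
  (forall T, T \subset S' -> ~~ odd #|T| -> exists D,
     [/\ D \subset E :&: inside S', [disjoint D & inside S],
         forall v, v \in S' -> v \notin S -> parity D v = (v \in T) &
         forall v, v \in S' -> exists2 u, u \in S &
           connect [rel x y | joins D x y || (x \in S) && (y \in S)] v u]) ->
  collapsible E S'.
Proof.
move=> cS sub ext T TS' Teven; have [D [DE dis par con]] := ext T TS' Teven.
have DS' : D \subset inside S' by apply: subset_trans DE (subsetIr _ _).
(* Off [S] the set [D] already has the required parities; its errors in [S] are even in number by
   the handshake lemma, and the collapsible [S] corrects them. *)
have [||D1 [D1E par1 con1]] := cS [set v | (v \in T) (+) parity D v].
- apply/subsetP => v; rewrite inE; apply: contraLR => vS.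
  have [vS'|vS'] := boolP (v \in S'); first by rewrite par // addbb.
  rewrite (parity_outside DS' vS') addbF.
  by apply: contra vS'; apply: (subsetP TS').
- rewrite odd_card_xor (negbTE (handshake D)) addbF.
  by have -> : [set v in T] = T; first by apply/setP => v; rewrite inE.
have dis1 : [disjoint D & D1].
  apply: disjointWr dis; exact: subset_trans D1E (subsetIr _ _).
exists (D :|: D1); split.
- rewrite subUset DE (subset_trans D1E) //.
  by rewrite setIS // insideS.
- by move=> v; rewrite parityU // par1 inE addbC addbK.
have con' u v : connect [rel x y | joins D x y || (x \in S) && (y \in S)] u v ->
    connect (joins (D :|: D1)) u v.
  apply: connect_sub => x y /= /orP[xy|/andP[xS yS]].
    by apply/connect1/(joinsS _ xy)/subsetUl.
  by apply: (joins_connectS (subsetUr D D1)); apply: con1.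
move=> x y /con[u uS /con' xu] /con[w wS /con' yw].
apply: connect_trans xu _; rewrite joins_connect_sym.
apply: connect_trans yw _; apply: (joins_connectS (subsetUr D D1)).
exact: con1.
Qed.

(** With [S] contracted, [v] hangs on it by two parallel edges: one is used if [v] must be odd, both
    if it must be even, and either way [v] is connected to [S]. *)
Lemma collapsible_add E S v e1 e2 u1 u2 : collapsible E S -> v \notin S ->
  e1 != e2 -> e1 \in E -> e2 \in E -> u1 \in S -> u2 \in S ->
  ends e1 = [set v; u1] -> ends e2 = [set v; u2] -> collapsible E (v |: S).
Proof.
move=> cS vS e12 e1E e2E u1S u2S E1 E2.
apply: collapsible_extend cS (subsetUr _ _) _ => T TS' Teven.
have i1 : e1 \in inside (v |: S).
  by rewrite inE E1 subUset !sub1set !inE eqxx u1S orbT.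
have i2 : e2 \in inside (v |: S).
  by rewrite inE E2 subUset !sub1set !inE eqxx u2S orbT.
have o1 : e1 \notin inside S by rewrite inE E1 subUset !sub1set (negbTE vS).
have o2 : e2 \notin inside S by rewrite inE E2 subUset !sub1set (negbTE vS).
have con D : e1 \in D -> forall w, w \in v |: S -> exists2 u, u \in S &
    connect [rel x y | joins D x y || (x \in S) && (y \in S)] w u.
  move=> e1D w /setU1P[->|wS]; last by exists w => //; apply: connect0.
  exists u1 => //; apply: connect1; rewrite /=.
  by rewrite (joinsI e1D E1).
have [vT|vT] := boolP (v \in T).
  exists [set e1]; split.
  - by rewrite sub1set inE e1E i1.
  - by rewrite disjoints1.
  - move=> w /setU1P[->|->//] _; by rewrite parity1 E1 set21 vT.
  - by apply: con; rewrite set11.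
exists [set e1; e2]; split.
- by rewrite subUset !sub1set !inE e1E e2E; rewrite !inE in i1 i2; rewrite i1 i2.
- by rewrite disjoint_subset; apply/subsetP => e; rewrite in_set2 => /orP[]/eqP->.
- move=> w /setU1P[->|->//] _.
  by rewrite parityU1 ?inE // parity1 E1 E2 !set21 (negbTE vT).
- by apply: con; rewrite set21.
Qed.

Lemma collapsible_triangle E x y z exy exz eyz : uniq [:: x; y; z] ->
  exy \in E -> exz \in E -> eyz \in E ->
  ends exy = [set x; y] -> ends exz = [set x; z] -> ends eyz = [set y; z] ->
  collapsible E [set x; y; z].
Proof.
rewrite /= !inE negb_or !andbT => /andP[/andP[xy xz] yz] Exy Exz Eyz xyE xzE yzE.
have Ux : x \in ends exy = true by rewrite xyE set21.
have yx : y \in ends exy = true by rewrite xyE set22.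
have x2 : x \in ends exz = true by rewrite xzE set21.
have y2 : y \in ends exz = false by rewrite xzE !inE eq_sym (negbTE xy) (negbTE yz).
have x3 : x \in ends eyz = false by rewrite yzE !inE (negbTE xy) (negbTE xz).
have y3 : y \in ends eyz = true by rewrite yzE set21.
have n12 : exy != exz by apply: contraTneq yx => ->; rewrite y2.
have n13 : exy != eyz by apply: contraTneq Ux => ->; rewrite x3.
have n23 : exz != eyz by apply: contraTneq x2 => ->; rewrite x3.
have sub e u v : ends e = [set u; v] -> u \in [set x; y; z] -> v \in [set x; y; z] ->
    e \in inside [set x; y; z].
  by move=> eE uS vS; rewrite inE eE subUset !sub1set uS vS.
have ixy : exy \in inside [set x; y; z] by apply: sub xyE _ _; rewrite !inE eqxx ?orbT.
have ixz : exz \in inside [set x; y; z] by apply: sub xzE _ _; rewrite !inE eqxx ?orbT.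
have iyz : eyz \in inside [set x; y; z] by apply: sub yzE _ _; rewrite !inE eqxx ?orbT.
have nloop e : e \notin inside [set z].
  by rewrite inE; apply/negP => /subset_leq_card; rewrite card_ends cards1.
(* The vertex [z] is taken as the contracted part, so only the parities at [x] and [y] are
   prescribed, which leaves four cases. *)
apply: (@collapsible_extend E [set z]); first exact: collapsible1.
  by rewrite sub1set !inE eqxx orbT.
move=> T _ _.
suff [D [DE par cx cy]] : exists D, [/\ D \subset [set exy; exz; eyz],
   (parity D x = (x \in T)) /\ (parity D y = (y \in T)),
   connect (joins D) x z & connect (joins D) y z].
  exists D; split.
  - apply: subset_trans DE _; rewrite !subUset !sub1set !inE.
    by move: ixy ixz iyz; rewrite !inE Exy Exz Eyz => -> -> ->.
  - rewrite -setI_eq0; apply/eqP/setP => e; rewrite !inE.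
    by have := nloop e; rewrite inE => /negbTE->; rewrite andbF.
  - move=> v; rewrite !inE -orbA => /or3P[]/eqP->; rewrite ?eqxx //; by case: par.
  - move=> v vS; exists z; first exact: set11.
    have : connect (joins D) v z.
      by move: vS; rewrite !inE -orbA => /or3P[]/eqP->.
    by apply: connect_sub => a b ab; apply: connect1; rewrite /= ab.
have j D e u v : ends e = [set u; v] -> e \in D -> connect (joins D) u v.
  by move=> eE eD; apply/connect1/(joinsI eD).
have j' D e u v : ends e = [set u; v] -> e \in D -> connect (joins D) v u.
  by rewrite joins_connect_sym; apply: j.
case: (boolP (x \in T)) => xT; case: (boolP (y \in T)) => yT.
- exists [set exz; eyz]; split.
  + by rewrite !subUset !sub1set !inE !eqxx ?orbT.
  + by rewrite !parityU1 ?inE // !parity1 x2 y2 x3 y3.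
  + by apply: j xzE _; rewrite !inE eqxx ?orbT.
  + by apply: j yzE _; rewrite !inE eqxx ?orbT.
- exists [set exy; eyz]; split.
  + by rewrite !subUset !sub1set !inE !eqxx ?orbT.
  + by rewrite !parityU1 ?inE // !parity1 Ux yx x3 y3.
  + apply: connect_trans (j _ _ _ _ xyE _) (j _ _ _ _ yzE _);
      by rewrite !inE eqxx ?orbT.
  + by apply: j yzE _; rewrite !inE eqxx ?orbT.
- exists [set exy; exz]; split.
  + by rewrite !subUset !sub1set !inE !eqxx ?orbT.
  + by rewrite !parityU1 ?inE // !parity1 Ux yx x2 y2.
  + by apply: j xzE _; rewrite !inE eqxx ?orbT.
  + apply: connect_trans (j' _ _ _ _ xyE _) (j _ _ _ _ xzE _);
      by rewrite !inE eqxx ?orbT.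
- exists (exy |: [set exz; eyz]); split.
  + by rewrite !subUset !sub1set !inE !eqxx ?orbT.
  + by rewrite !parityU1 ?inE ?negb_or ?n12 ?n13 // !parity1 Ux yx x2 y2 x3 y3.
  + by apply: j xzE _; rewrite !inE eqxx ?orbT.
  + by apply: j yzE _; rewrite !inE eqxx ?orbT.
Qed.

(** Contract [S1]. A subgraph supplied by [S2] with the right parities off [S1] keeps them when its
    edges inside [S1] are dropped, and the contraction restores the connections lost. *)
Lemma collapsible_union E S1 S2 u : collapsible E S1 -> collapsible E S2 ->
  u \in S1 -> u \in S2 -> collapsible E (S1 :|: S2).
Proof.
move=> c1 c2 u1 u2; apply: collapsible_extend (c1) (subsetUl _ _) _ => T TS Teven.
(* The vertex [u] is added when needed to make the prescribed set even; as [u] lies in [S1], its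
   parity is free. *)
pose T2 := [set v in T | v \notin S1] :|: (if odd #|[set v in T | v \notin S1]|
             then [set u] else set0).
have [||D [DE par con]] := c2 T2.
- rewrite subUset; apply/andP; split; last by case: ifP; rewrite ?sub0set ?sub1set.
  apply/subsetP => v; rewrite inE => /andP[/(subsetP TS)].
  by rewrite inE => /orP[->|].
- rewrite /T2; case: (boolP (odd #|[set v in T | v \notin S1]|)) => odd1; last by rewrite setU0.
  by rewrite setUC cardsU1 !inE u1 andbF /= odd1.
have DS2 : D \subset inside S2 by apply: subset_trans DE (subsetIr _ _).
exists (D :\: inside S1); split.
- apply: subset_trans (subsetDl _ _) (subset_trans DE _).
  by apply: setIS; apply: insideS; apply: subsetUr.
- by rewrite -setI_eq0 setIDAC setDIl setDv setI0.
- move=> v _ v1; rewrite /parity.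
  have -> : [set e in D :\: inside S1 | v \in ends e] = [set e in D | v \in ends e]; last first.
    rewrite -/(parity D v) par !inE v1 andbT; case: ifP => _; rewrite ?inE ?orbF //.
    by case: eqVneq v1 => [->|]; rewrite ?u1 ?orbF.
  apply/setP => e; rewrite !inE; case: (boolP (v \in ends e)); rewrite ?andbF //.
  move=> ve; rewrite !andbT andb_idl // => _.
  by apply: contra v1 => /subsetP; apply.
move=> v /setUP[v1|v2]; first by exists v.
exists u => //; have : connect (joins D) v u by apply: con.
apply: connect_sub => a b /existsP[e /andP[eD /eqP eE]]; apply: connect1.
rewrite /=; have [e1|e1] := boolP (e \in inside S1).
  by move: e1; rewrite inE eE subUset !sub1set => ->; rewrite orbT.
by apply/orP; left; apply: joinsI eE; rewrite inE e1.
Qed.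

End Collapsible.

Lemma supereulerian_collapsible (G : mgraph) s t : 0 < #|vert G| ->
  (forall Z : {set edge G}, #|Z| <= s + t -> collapsible (~: Z) setT) ->
  supereulerian s t G.
Proof.
move=> /card_gt0P[x _] cG X Y dXY Xs Yt.
have cXY : collapsible (~: (X :|: Y)) setT.
  exact: cG (leq_trans (leq_card_setU _ _) (leq_add Xs Yt)).
have [||D [DE par con]] := cXY [set v | parity X v].
- exact: subsetT.
- exact: handshake.
have DXY e : e \in D -> e \notin X :|: Y.
  by move/(subsetP DE); rewrite in_setI in_setC => /andP[].
have DX : [disjoint D & X].
  rewrite -setI_eq0; apply/eqP/setP => e; rewrite !inE; apply/negP.
  by case/andP=> /DXY; rewrite inE negb_or => /andP[/negP].
have [||p [ct sp pE]] := @euler G (D :|: X) x.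
- by move=> v; rewrite parityU // par inE addbb.
- move=> u v; apply: (joins_connectS (subsetUl D X)).
  by apply: con; rewrite inE.
have /and3P[w U /eqP l] := ct.
have [|p' [w' E1 E2]] := @walk_lift G Y x p w.
  apply/allP => e; rewrite pE inE => /orP[/DXY|eX]; last by rewrite (disjointFr dXY eX).
  by rewrite inE negb_or => /andP[].
exists x, p'; split.
- rewrite /closed_trail w' E2 l eqxx andbT /=.
  by rewrite -(map_inj_uniq val_inj) E1.
- by apply/forallP => v; move/forallP: sp => /(_ v); rewrite /walk_verts E2.
- by move=> e eX; rewrite E1 pE inE eX orbT.
Qed.

(** * Cliques of the line graph *)

Lemma clique_edges_at (G : mgraph) (S : {set vert G}) v : simple_graph G ->
  {in S &, forall x y, x != y -> adjacent x y} -> v \in S ->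
  #|[set e in inside S | v \in ends e]| = #|S :\ v|.
Proof.
move=> simpG clS vS; rewrite -(card_imset _ simpG).
rewrite -[RHS](card_in_imset (f := fun y => [set v; y])).
  apply: eq_card => A; apply/imsetP/imsetP => -[].
    move=> e; rewrite !inE => /andP[eS ve] ->; have [y vy eE] := endsP ve.
    exists y => //; rewrite !inE eq_sym vy; move: eS.
    by rewrite eE subUset !sub1set => /andP[].
  move=> y; rewrite !inE => /andP[yv yS] ->.
  have /adjacentP[e eE] : adjacent v y by apply: clS => //; rewrite eq_sym.
  by exists e => //; rewrite !inE eE subUset !sub1set vS yS set21.
move=> y z; rewrite !inE => /andP[yv _] _ yz; apply: (set2_other yz).
by rewrite eq_sym.
Qed.

(** Induction on [#|S|]. An end [v] of a missing edge, or any vertex if none is missing, is removed;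
    this preserves the bound, which also leaves [v] two edges to the rest, so [collapsible_add]
    restores it. At size 3 no edge is missing and [S] is a triangle. *)
Lemma collapsible_clique (G : mgraph) (Z : {set edge G}) (S : {set vert G}) :
  simple_graph G -> {in S &, forall x y, x != y -> adjacent x y} ->
  #|Z :&: inside S| + 3 <= #|S| -> collapsible (~: Z) S.
Proof.
move=> simpG; have [n] := ubnP #|S|; elim: n S => // n IH S Sn clS ZS.
have [S3|S4] := leqP #|S| 3.
  have Z0 e : e \in inside S -> e \in ~: Z.
    move=> eS; rewrite inE; apply/negP => eZ.
    have : 0 < #|Z :&: inside S| by apply/card_gt0P; exists e; rewrite inE eZ.
    by lia.
  have /card_gt2P[x [y [z [[xS yS zS] [xy yz zx]]]]] : 2 < #|S| by lia.
  have xz : x != z by rewrite eq_sym.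
  have SE : [set x; y; z] = S.
    apply/eqP; rewrite eqEcard; apply/andP; split.
      by rewrite !subUset !sub1set xS yS zS.
    by rewrite (leq_trans S3) // setUC cardsU1 cards2 xy !inE negb_or zx eq_sym yz.
  have ed u v : u \in S -> v \in S -> u != v ->
      exists2 e, e \in ~: Z & ends e = [set u; v].
    move=> uS vS uv; have /adjacentP[e eE] := clS u v uS vS uv.
    by exists e => //; apply: Z0; rewrite inE eE subUset !sub1set uS.
  have [e1 e1Z e1E] := ed x y xS yS xy; have [e2 e2Z e2E] := ed x z xS zS xz.
  have [e3 e3Z e3E] := ed y z yS zS yz.
  rewrite -SE; apply: (collapsible_triangle _ e1Z e2Z e3Z e1E e2E e3E).
  by rewrite /= !inE negb_or xy xz yz.
have [v vS ltZ] : exists2 v, v \in S &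
    #|Z :&: inside (S :\ v)| + 3 <= #|S :\ v|.
  have le v : Z :&: inside (S :\ v) \subset Z :&: inside S.
    by apply: setIS; apply: insideS; apply: subD1set.
  have [Z0|[e /setIP[eZ]]] := set_0Vmem (Z :&: inside S).
    have /card_gt0P[v vS] : 0 < #|S| by lia.
    exists v => //; move: S4; rewrite (cardsD1 v) vS.
    by have := subset_leq_card (le v); rewrite Z0 cards0; lia.
  rewrite inE => /subsetP eS; have [v [w [_ eE]]] := ends_pair e.
  have vS : v \in S by apply: eS; rewrite eE set21.
  exists v => //; move: ZS; rewrite (cardsD1 v) vS.
  suff : #|Z :&: inside (S :\ v)| < #|Z :&: inside S| by lia.
  apply: proper_card; apply/properP; split => //; exists e.
    by rewrite !inE eZ; apply/subsetP.
  by rewrite !inE eZ eE subUset sub1set !inE eqxx.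
have : 1 < #|[set e in inside S | v \in ends e] :\: Z|.
  rewrite cardsD clique_edges_at //; move: ZS; rewrite (cardsD1 v) vS.
  suff : #|[set e in inside S | v \in ends e] :&: Z| <= #|Z :&: inside S| by lia.
  apply: subset_leq_card; rewrite setIC; apply: setIS.
  by apply/subsetP => e; rewrite !inE => /andP[].
case/card_gt1P=> e1 [e2 []]; rewrite !inE => /andP[e1Z /andP[e1S ve1]].
case/andP=> e2Z /andP[e2S ve2] e12.
have [u1 vu1 e1E] := endsP ve1; have [u2 vu2 e2E] := endsP ve2.
rewrite -(setD1K vS).
apply: (@collapsible_add _ _ _ _ e1 e2 u1 u2); rewrite ?inE ?eqxx //.
- apply: IH ltZ; first by move: Sn; rewrite (cardsD1 v) vS; lia.
  by move=> x y /setD1P[_ xS] /setD1P[_ yS]; apply: clS.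
- by rewrite eq_sym vu1; move: e1S; rewrite e1E subUset !sub1set => /andP[].
- by rewrite eq_sym vu2; move: e2S; rewrite e2E subUset !sub1set => /andP[].
Qed.

Lemma line_star_collapsible (G : mgraph) (Z : {set edge (line_graph G)}) v :
  #|Z| + 3 <= deg v ->
  @collapsible (line_graph G) (~: Z) [set e : edge G | v \in ends e].
Proof.
move=> Zv; apply: collapsible_clique; first exact: line_simple.
  by move=> e f; rewrite !inE => ve vf ef; apply: line_adjacentI ve vf.
apply: leq_trans Zv; rewrite leq_add2r subset_leq_card //; exact: subsetIl.
Qed.

(** The stars of the vertices in [M] are large cliques of the line graph, hence collapsible, and the
    stars of adjacent vertices share the edge joining them; so they merge along walks inside [M]. *)
Lemma line_collapsible (G : mgraph) (Z : {set edge (line_graph G)})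
    (M : pred (vert G)) x :
  M x -> (forall y, M y -> connect (within M) x y) ->
  (forall y, M y -> #|Z| + 3 <= deg y) ->
  @collapsible (line_graph G) (~: Z) [set e : edge G | [exists v in ends e, M v]].
Proof.
move=> Mx con degM; set target := [set e | _].
pose star v := [set e : edge G | v \in ends e].
have starM v : M v -> star v \subset target.
  by move=> Mv; apply/subsetP => e; rewrite !inE => ve; apply/existsP; exists v; rewrite ve.
have cstar v : M v -> @collapsible (line_graph G) (~: Z) (star v).
  by move=> /degM; apply: line_star_collapsible.
(* Each set keeps the star of [x], so that the sets obtained for different [y] overlap and can be
   merged at the end. *)
pose C y := exists S, [/\ @collapsible (line_graph G) (~: Z) S, S \subset target,
  star x \subset S & star y \subset S].
have CM y : M y -> C y.
  move=> My; have /connectP[p] := con y My.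
  have : C x by exists (star x); split; rewrite ?subxx ?starM //; apply: cstar.
  elim: p {1 2 3}x => [|z p IH] u Cu /=; first by move=> _ ->.
  case/andP=> /and3P[/adjacentP[e eE] Mu Mz]; apply: IH.
  have [S [cS St Sx Su]] := Cu; exists (S :|: star z); split.
  - apply: (@collapsible_union (line_graph G) _ _ _ e) cS (cstar z Mz) _ _.
      by apply: (subsetP Su); rewrite inE eE set21.
    by rewrite inE eE set22.
  - by rewrite subUset St starM.
  - by apply: subset_trans Sx (subsetUl _ _).
  - exact: subsetUr.
have /card_gt0P[e0] : 0 < deg x by apply: leq_trans (degM x Mx); rewrite addn3.
move=> e0x.
have [S [cS St Sx SM]] : exists S, [/\ @collapsible (line_graph G) (~: Z) S,
    S \subset target, star x \subset S &
    forall y, y \in enum M -> star y \subset S].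
  have : all M (enum M) by apply/allP => y; rewrite mem_enum.
  elim: (enum M) => [_|y r IH /= /andP[/CM[S1 [c1 t1 x1 y1]] /IH[S2 [c2 t2 x2 r2]]]].
    by exists (star x); split; rewrite ?starM //; apply: cstar.
  exists (S1 :|: S2); split.
  - apply: (@collapsible_union (line_graph G) _ _ _ e0) c1 c2 _ _; first exact: (subsetP x1).
    exact: (subsetP x2).
  - by rewrite subUset t1.
  - exact: subset_trans x1 (subsetUl _ _).
  - move=> z; rewrite inE => /orP[/eqP->|/r2 zr].
      exact: subset_trans y1 (subsetUl _ _).
    exact: subset_trans zr (subsetUr _ _).
suff -> : target = S by [].
apply/eqP; rewrite eqEsubset St andbT; apply/subsetP => e.
rewrite inE => /existsP[y /andP[ye My]].
by apply: (subsetP (SM y _)); rewrite ?mem_enum ?inE.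
Qed.

(** * Minimum degree of iterated line graphs *)

Lemma deg_le_size (G : mgraph) (v : vert G) : deg v <= #|edge G|.
Proof. exact: max_card. Qed.

Lemma min_deg_le (G : mgraph) (v : vert G) : min_deg G <= deg v.
Proof.
rewrite /min_deg; have := mem_index_enum v.
elim: (index_enum _) => // w r IH; rewrite inE big_cons geq_min.
by case/orP=> [/eqP->|/IH->]; rewrite ?leqnn ?orbT.
Qed.

Lemma leq_min_deg (G : mgraph) k (v : vert G) :
  (forall v : vert G, k <= deg v) -> k <= min_deg G.
Proof.
move=> kG; rewrite /min_deg; elim/big_ind: _ => //.
  exact: leq_trans (kG v) (deg_le_size v).
by move=> a b ka kb; rewrite leq_min ka.
Qed.

Lemma line_supereulerian (G : mgraph) s t : connected_graph G ->
  s + t + 3 <= min_deg G -> supereulerian s t (line_graph G).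
Proof.
move=> conG dG; have [/card_gt0P[x _] con] := conG.
have dle v : s + t + 3 <= deg v := leq_trans dG (min_deg_le v).
apply: supereulerian_collapsible => [|Z Zst].
  have : 0 < deg x by apply: leq_trans (dle x); rewrite addn3.
  by case/card_gt0P=> e _; apply/card_gt0P; exists e.
rewrite (_ : setT = [set e : edge G | [exists v in ends e, predT v]]).
  apply: (@line_collapsible _ _ predT x) => // y _.
    by rewrite (eq_connect (@within_predT G)).
  by apply: leq_trans (dle y); rewrite leq_add2r.
apply/setP => e; rewrite !inE; apply/esym/existsP.
by have [v [w [_ eE]]] := ends_pair e; exists v; rewrite eE set21.
Qed.

Lemma iter_line_simple (G : mgraph) i : simple_graph G -> simple_graph (iter_line i G).
Proof. by case: i => // i _; apply: line_simple. Qed.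

(** By [line_deg] the excess of the minimum degree over 2 at least doubles with each line graph. *)
Lemma iter_line_min_deg (G : mgraph) i k : simple_graph G -> connected_graph G ->
  0 < k -> k + 2 <= min_deg G ->
  connected_graph (iter_line i G) /\ 2 ^ i * k + 2 <= min_deg (iter_line i G).
Proof.
move=> simpG conG k0 dG; elim: i => [|i [conH dH]]; first by rewrite mul1n.
have simpH : simple_graph (iter_line i G) := iter_line_simple simpG.
have [/card_gt0P[x _] _] := conH.
have /card_gt0P[e _] : 0 < deg x.
  by apply: leq_trans (min_deg_le x); apply: leq_trans dH; rewrite addn2.
split; first by apply: line_connected conH; exact: e.
apply: (@leq_min_deg (line_graph (iter_line i G)) _ e) => f.
have [u [v [_ fE]]] := ends_pair f; have := line_deg simpH fE.
by have := min_deg_le u; have := min_deg_le v; rewrite expnS; lia.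
Qed.

(** The first [r] line graphs raise the minimum degree to at least [s + t + 3]; the last one is
    spent on [line_supereulerian]. *)
Lemma iter_line_supereulerian (G : mgraph) s t r : simple_graph G ->
  connected_graph G -> 2 < min_deg G -> s + t + 1 <= 2 ^ r * (min_deg G - 2) ->
  supereulerian s t (iter_line r.+1 G).
Proof.
move=> simpG conG dG str.
have [||conH dH] := @iter_line_min_deg G r (min_deg G - 2) simpG conG; try lia.
by apply: line_supereulerian conH _; lia.
Qed.

(** * Divalent paths in the line graph *)

(** The proper divalent paths of a simple graph as vertex sequences; values beyond [n] are
    irrelevant. A path of length 2 lies in a triangle exactly when its ends are adjacent. *)
Definition divalent_seq (G : mgraph) n (u : nat -> vert G) : Prop :=
  [/\ forall i, i < n -> adjacent (u i) (u i.+1),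
      forall i j, i <= n -> j <= n -> u i = u j -> i = j,
      forall i, 0 < i < n -> deg (u i) = 2
    & n = 2 -> ~~ adjacent (u 0) (u 2)].

(* Unlike the plain bound [ell G < n], this weaker property passes to the line
   graph with [n] decreased by one even when a long branch closes up into a cycle. *)
Definition branches_bypassed (G : mgraph) n : Prop :=
  forall u : nat -> vert G, divalent_seq n u ->
  connect (within (@branching G)) (u 0) (u n).

(** For a simple graph, the existence of an edge of degree at least 3 in the line graph. It passes
    to line graphs and rules out paths, cycles and the claw. *)
Definition heavy_edge (G : mgraph) : Prop :=
  exists (e : edge G) (u v : vert G), ends e = [set u; v] /\ 4 < deg u + deg v.

Section Heavy.

Variable G : mgraph.
Hypothesis simpG : simple_graph G.

Lemma heavy_branching : heavy_edge G -> exists v, @branching G v.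
Proof.
case=> e [u [v [_ d5]]]; have [d3|d3] := ltnP 2 (deg u); first by exists u.
by exists v; rewrite /branching; lia.
Qed.

(** At an end of degree at least 3, the heavy edge [e] meets two more edges [f] and [g]. In the line
    graph [e] has degree at least 3 and [f], adjacent to [e] and [g], at least 2. *)
Lemma heavy_line : heavy_edge G -> heavy_edge (line_graph G).
Proof.
case=> e [u [v [eE d5]]]; wlog d3 : u v eE d5 / 2 < deg u.
  move=> W; have [d3|d3] := ltnP 2 (deg u); first exact: W eE d5 d3.
  by apply: (W v u); [rewrite setUC | rewrite addnC | lia].
have ue : u \in ends e by rewrite eE set21.
have /card_gt1P[f [g []]] : 1 < #|[set f : edge G | u \in ends f] :\ e|.
  by move: d3; rewrite /deg (cardsD1 e) inE ue.
rewrite !inE => /andP[fe uf] /andP[ge ug] fg.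
have fe' : @adjacent (line_graph G) f e := line_adjacentI fe uf ue.
have fg' : @adjacent (line_graph G) f g := line_adjacentI fg uf ug.
have /adjacentP[a aE] := fe'; exists a, f, e; split => //.
have : 1 < @deg (line_graph G) f.
  by apply/(deg_gt1P (@line_simple G)); exists e, g; rewrite eq_sym.
by have := line_deg simpG eE; lia.
Qed.

Lemma deg_gt0 (e : edge G) v : v \in ends e -> 0 < deg v.
Proof. by move=> ve; apply/card_gt0P; exists e; rewrite inE. Qed.

End Heavy.

Section LineBranches.

Variables (G : mgraph) (n : nat) (e : nat -> edge G).
Hypotheses (simpG : simple_graph G) (n2 : 1 < n).
Hypothesis dive : @divalent_seq (line_graph G) n e.

Let adj i : i < n -> @adjacent (line_graph G) (e i) (e i.+1).
Proof. by case: dive => + _ _ _; apply. Qed.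

Let adjp i : 0 < i <= n -> @adjacent (line_graph G) (e i) (e i.-1).
Proof. by case: i => // i lt; rewrite adjacent_sym; apply: adj. Qed.

Let inj i j : i <= n -> j <= n -> e i = e j -> i = j.
Proof. by case: dive => _ + _ _; apply. Qed.

Let neq i j : i <= n -> j <= n -> i != j -> e i != e j.
Proof. by move=> ? ? ij; apply: contraNneq ij => /inj->. Qed.

Let dege i : 0 < i < n -> @deg (line_graph G) (e i) = 2.
Proof. by case: dive => _ _ + _; apply. Qed.

Let nclosed : n = 2 -> ~~ @adjacent (line_graph G) (e 0) (e 2).
Proof. by case: dive. Qed.

(* A pendant edge at a vertex of degree 3 also has degree 2 in the line graph,
   but there its two neighbours are adjacent. *)
Lemma divalent_line_ends i v : 0 < i < n -> v \in ends (e i) -> deg v = 2.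
Proof.
move=> i0 vi; have [w vw eE] := endsP vi; have := line_deg simpG eE.
rewrite dege // => D; have we : w \in ends (e i) by rewrite eE set22.
have dv := deg_gt0 vi; have dw := deg_gt0 we.
(* The end degrees are positive with sum 4, so a failure would make one end pendant. *)
suff no a b : ends (e i) = [set a; b] -> deg a = 1 -> False.
  case: (ltngtP (deg v) 2) => // dv2.
    by exfalso; apply: (no v w eE); lia.
  by exfalso; apply: (no w v); rewrite 1?setUC //; lia.
move=> abE da.
have atb f : @adjacent (line_graph G) (e i) f -> b \in ends f.
  case/line_adjacentP=> ef [c []]; rewrite abE !inE => /orP[]/eqP-> // af.
  have ae : a \in ends (e i) by rewrite abE set21.
  have : 1 < deg a by apply/card_gt1P; exists (e i), f; rewrite !inE.
  by rewrite da.
have bp : b \in ends (e i.-1).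
  by apply: atb; apply: adjp; lia.
have bn : b \in ends (e i.+1) by apply: atb; apply: adj; lia.
have pn : @adjacent (line_graph G) (e i.-1) (e i.+1).
  by apply: line_adjacentI bp bn; apply: neq; lia.
have [nE|n3] := eqVneq n 2.
  have iE : i = 1 by lia.
  by move: (nclosed nE); rewrite iE in pn; rewrite pn.
(* For [n > 2] one of the two path neighbours of [e i] is internal; it is adjacent to [e i], to the
   other neighbour and to the next edge of the path, so its degree is at least 3. *)
have [lt|ge] := ltnP i.+1 n.
  have : 2 < @deg (line_graph G) (e i.+1).
    apply: (three_neighbours (@line_simple G) (x := e i.-1) (y := e i) (z := e i.+2)).
    - by rewrite /= !inE negb_or !neq //; lia.
    - by rewrite adjacent_sym.
    - by rewrite adjacent_sym; apply: adj; lia.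
    - by apply: adj; lia.
  by rewrite dege //; lia.
have : 2 < @deg (line_graph G) (e i.-1).
  apply: (three_neighbours (@line_simple G) (x := e i.-2) (y := e i) (z := e i.+1)) => //.
  - by rewrite /= !inE negb_or !neq //; lia.
  - by apply: adjp; lia.
  - by rewrite adjacent_sym; apply: adjp; lia.
by rewrite dege //; lia.
Qed.

(** Consecutive edges share a vertex; these common vertices, with an outer end [a] of [e 0] and [b]
    of [e n], form a divalent walk longer by one, which can repeat a vertex only by closing up. *)
Lemma unfold_divalent_line : exists u : nat -> vert G,
  [/\ forall i, i <= n -> ends (e i) = [set u i; u i.+1],
      forall i, 0 < i <= n -> deg (u i) = 2
    & forall i j, i <= n.+1 -> j <= n.+1 -> u i = u j ->
        i = j \/ (i = 0 /\ j = n.+1) \/ (i = n.+1 /\ j = 0)].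
Proof.
have common i : exists v, i < n -> v \in ends (e i) /\ v \in ends (e i.+1).
  case: (ltnP i n) => [/adj/line_adjacentP[_ [v]]|_]; first by exists v.
  by have [v _] := ends_pair (e i); exists v.
have [c cP] := choice common.
have c0 : c 0 \in ends (e 0) by have [] := cP 0 ltac:(lia).
have cn : c n.-1 \in ends (e n).
  by have [_] := cP n.-1 ltac:(lia); rewrite prednK //; lia.
have [a _ aE] := endsP c0; have [b _ bE] := endsP cn.
pose u i := if i is j.+1 then if j < n then c j else b else a.
have uE i : i <= n -> ends (e i) = [set u i; u i.+1].
  case: i => [_|i lt] /=; first by rewrite (ltnW n2) setUC.
  rewrite lt; have [lt2|ge] := ltnP i.+1 n; last first.
    have iE : i.+1 = n by lia.
    by rewrite iE bE; congr [set c _; b]; lia.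
  have [_ ci] := cP i lt; have [cj _] := cP i.+1 lt2.
  (* Otherwise [e i], [e i.+1] and [e i.+2] would meet at a vertex of degree 2. *)
  have cc : c i != c i.+1.
    apply/eqP => ccE; have d2 : deg (c i) = 2.
      by apply: (divalent_line_ends _ ci); lia.
    have : 2 < deg (c i).
      apply: (three_edges (e := e i) (f := e i.+1) (g := e i.+2)) => //.
      - by rewrite /= !inE negb_or !neq //; lia.
      - by have [] := cP i lt.
      - by rewrite ccE; have [] := cP i.+1 lt2.
    by rewrite d2.
  have [w _ E] := endsP ci; rewrite E.
  by move: cj; rewrite E !inE eq_sym (negbTE cc) /= => /eqP->.
have uin i : 0 < i <= n -> u i \in ends (e i.-1) /\ u i \in ends (e i).
  case: i => // i lt; rewrite /= !uE ?set21 ?set22 //; lia.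
have degu i : 0 < i <= n -> deg (u i) = 2.
  move=> lt; have [ui1 ui] := uin i lt.
  have [ltn|ge] := ltnP i n; first by apply: (divalent_line_ends _ ui); lia.
  by apply: (divalent_line_ends _ ui1); lia.
have at2 i k : 0 < i <= n -> k <= n -> u i \in ends (e k) -> (k == i.-1) || (k == i).
  move=> lt kn uk; have [ui1 ui] := uin i lt.
  have ne : e i.-1 != e i by apply: neq; lia.
  have := deg2_edges (degu i lt) ne ui1 ui uk.
  by case/orP=> /eqP/inj->; rewrite ?eqxx ?orbT //; lia.
exists u; split=> //.
have ord i j : i < j <= n.+1 -> u i = u j -> i = 0 /\ j = n.+1.
  move=> ij uij; have ne k : k <= n -> u k != u k.+1 by move=> /uE/ends_neq.
  have [i0|i0] := posnP i.
    split=> //; apply/eqP; apply: contraT => jn.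
    have lt : 0 < j <= n by lia.
    have := at2 j 0 lt (leq0n n); rewrite -uij i0 (uE 0) // set21 => /(_ isT) j01.
    have jE : j = 1 by lia.
    by have := ne 0 (leq0n n); rewrite -i0 uij jE i0 eqxx.
  have lt : 0 < i <= n by lia.
  have jn : u i \in ends (e j.-1).
    by rewrite uij uE; [have -> : j.-1.+1 = j by lia | lia]; rewrite set22.
  have := at2 i j.-1 lt ltac:(lia) jn => jE.
  have {}jE : j = i.+1 by lia.
  by have := ne i ltac:(lia); rewrite uij jE eqxx.
move=> i j li lj uij; case: (ltngtP i j) => ij; last by left.
  by right; left; apply: ord uij; rewrite ij.
by right; right; have [] := ord j i _ (esym uij); rewrite ?ij.
Qed.

End LineBranches.

(** The path unfolds into a walk of length [n.+1] in [G]. If it is open, its bypass carries over by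
    [line_connect]. If it closes up, its first and last edges are adjacent, and both branch because
    the closing vertex does. *)
Lemma line_branches_bypassed (G : mgraph) n : simple_graph G ->
  connected_graph G -> heavy_edge G -> 1 < n ->
  branches_bypassed G n.+1 -> branches_bypassed (line_graph G) n.
Proof.
move=> simpG conG heavy n2 byp e dive.
have [u [uE degu inju]] := unfold_divalent_line simpG n2 dive.
have e0n : e 0 != e n.
  by apply/eqP; case: dive => _ inj _ _ /inj; lia.
have u0e : u 0 \in ends (e 0) by rewrite uE ?set21.
have une : u n.+1 \in ends (e n) by rewrite uE ?set22.
have brE i x y : i <= n -> ends (e i) = [set x; y] -> 4 < deg x + deg y ->
    @branching (line_graph G) (e i).
  by move=> _ /(line_deg simpG); rewrite /branching; lia.
have [u0n|u0n] := eqVneq (u 0) (u n.+1); last first.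
  have divu : divalent_seq n.+1 u.
    split=> [i lt|i j li lj uij|i lt|]; last by lia.
    - by apply/adjacentP; exists (e i); apply: uE.
    - case: (inju i j li lj uij) => [//|[[i0 jn]|[i0 jn]]]; move: u0n;
        by rewrite -i0 -jn uij eqxx.
    - by apply: degu; lia.
  have c := byp u divu; have [b0 bn] := within_connect_neq c u0n.
  apply: (line_connect _ c u0e une).
  - by move=> g x y /(line_deg simpG); rewrite /branching; lia.
  - apply: (brE 0 _ _ _ (uE 0 _)) => //; rewrite (degu 1); last by lia.
    by move: b0; rewrite /branching; lia.
  - apply: (brE n _ _ _ (uE n _)) => //; rewrite (degu n); last by lia.
    by move: bn; rewrite /branching; lia.
have d0 : 2 < deg (u 0).
  rewrite ltn_neqAle; apply/andP; split; last first.
    by apply/card_gt1P; exists (e 0), (e n); rewrite !inE u0e u0n une.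
  (* Were the closing vertex of degree 2, the closed walk would be all of [G] by connectedness,
     leaving no branching vertex. *)
  apply/eqP => d2; have [v] := heavy_branching heavy; rewrite /branching.
  suff : exists2 i, i <= n & v = u i.
    case=> i lt ->; case: (posnP i) => [->|i0]; first by rewrite -d2.
    by rewrite degu //; lia.
  apply: (@connected_closed G (fun v => exists2 i, i <= n & v = u i) (u 0) conG).
    by exists 0.
  move=> x y [i lt ->] /adjacentP[g gE].
  have ug : u i \in ends g by rewrite gE set21.
  have [j jn gj] : exists2 j, j <= n & g = e j.
    case: (posnP i) => [i0|i0].
      have une' : u i \in ends (e n) by rewrite i0 u0n.
      have u0e' : u i \in ends (e 0) by rewrite i0.
      have d2' : deg (u i) = 2 by rewrite i0 -d2.
      by case/orP: (deg2_edges d2' e0n u0e' une' ug) => /eqP->; [exists 0|exists n].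
    have ui : u i \in ends (e i) by rewrite uE // set21.
    have ui1 : u i \in ends (e i.-1).
      by rewrite uE; [rewrite prednK // set22|lia].
    have ne : e i.-1 != e i by apply/eqP; case: dive => _ inj _ _ /inj; lia.
    case/orP: (deg2_edges (degu i ltac:(lia)) ne ui1 ui ug) => /eqP->;
      [exists i.-1 => //; lia|by exists i].
  have : y \in ends g by rewrite gE set22.
  rewrite gj uE // !inE => /orP[]/eqP->; first by exists j.
  by case: (ltngtP j n) jn => // [jlt _|-> _]; [exists j.+1|exists 0].
apply: connect1; rewrite /within /= (line_adjacentI e0n u0e) /=; last by rewrite u0n.
apply/andP; split.
  by apply: (brE 0 _ _ _ (uE 0 _)) => //; rewrite (degu 1); lia.
by apply: (brE n _ _ _ (uE n _)) => //; rewrite (degu n) -?u0n; lia.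
Qed.

(** * Graphs with short branches *)

Section ShortBranches.

Variable G : mgraph.
Hypotheses (simpG : simple_graph G) (conG : connected_graph G).
Hypotheses (heavyG : heavy_edge G) (byp : branches_bypassed G 2).
Implicit Types (u v w x y z : vert G) (e f : edge G).

Lemma bypass2 x v y : adjacent x v -> adjacent v y -> x != y -> deg v = 2 ->
  ~~ adjacent x y -> connect (within (@branching G)) x y.
Proof.
move=> xv vy xy dv nxy.
apply: (byp (u := fun i => if i is j.+1 then if j is 0 then v else y else x)).
split => //; first by case=> [|[|]].
  have nxv := adjacent_neq xv; have nvy := adjacent_neq vy.
  by case=> [|[|[|]]] // [|[|[|]]] // _ _ E; move: nxv nvy xy; rewrite E eqxx.
by case=> [|[|]].
Qed.

Lemma small_component x (P : vert G -> Prop) : P x ->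
  (forall u v, P u -> adjacent u v -> P v) -> (forall u, P u -> ~~ branching u) ->
  False.
Proof.
move=> Px cl nb; have [v bv] := heavy_branching heavyG.
by have := nb v (connected_closed conG Px cl v); rewrite bv.
Qed.

(** Let [v] have degree 2 and other neighbour [w]. Unless [w] is adjacent to [u], the path [u], [v],
    [w] is bypassed, which makes [u] branching. So the three form a triangle, and [w] branches, for
    otherwise the triangle would be all of [G]. *)
Lemma nonbranching_edge e u v : ends e = [set u; v] ->
  ~~ branching u -> ~~ branching v ->
  [/\ deg u = 2, deg v = 2 &
      exists w, [/\ branching w, adjacent u w & adjacent v w]].
Proof.
(* If neither end has degree 2, both have degree 1 and the edge is all of [G]. *)
move=> eE nu nv; wlog d2 : u v eE nu nv / deg v = 2.
  move=> W; have [dv|dv] := eqVneq (deg v) 2; first exact: W dv.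
  have [du|du] := eqVneq (deg u) 2.
    have [|dv2 _ [w [bw vw uw]]] := W v u _ nv nu du; first by rewrite setUC.
    by split=> //; exists w.
  exfalso; have uv := ends_neq eE.
  have one y z : (y = u \/ y = v) -> adjacent y z -> z = u \/ z = v.
    have auv : adjacent u v by apply/adjacentP; exists e.
    have avu : adjacent v u by rewrite adjacent_sym.
    case=> -> yz; [right|left]; apply/eqP; apply: contraT => ne.
      have : 1 < deg u by apply/(deg_gt1P simpG); exists z, v.
      by move: nu du; rewrite /branching; lia.
    have : 1 < deg v by apply/(deg_gt1P simpG); exists z, u.
    by move: nv dv; rewrite /branching; lia.
  apply: (@small_component u (fun y => y = u \/ y = v)); first by left.
    by move=> y z; apply: one.
  by move=> y [->|->].
have uv : adjacent u v by apply/adjacentP; exists e.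
have vu : adjacent v u by rewrite adjacent_sym.
have [w vw wu] := another_neighbour simpG u (eq_leq (esym d2) : 1 < deg v).
have uw : adjacent u w.
  apply: contraT => nuw; rewrite eq_sym in wu.
  have c := bypass2 uv vw wu d2 nuw.
  by have [bu] := within_connect_neq c wu; rewrite bu in nu.
have nvw := adjacent_neq vw.
have du : deg u = 2.
  have : 1 < deg u by apply/(deg_gt1P simpG); exists v, w.
  by move: nu; rewrite /branching; lia.
split => //; exists w; split => //; apply: contraT => nw; exfalso.
have wu' : adjacent w u by rewrite adjacent_sym.
have wv' : adjacent w v by rewrite adjacent_sym.
have uv' := adjacent_neq uv.
have dw : deg w = 2.
  have : 1 < deg w by apply/(deg_gt1P simpG); exists u, v.
  by move: nw; rewrite /branching; lia.
apply: (@small_component u (fun y => y \in [set u; v; w])).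
- by rewrite !inE eqxx.
- move=> y z; rewrite !inE -!orbA => /or3P[]/eqP-> yz.
  + by case/orP: (deg2_neighbours simpG du nvw uv uw yz) => ->; rewrite ?orbT.
  + rewrite eq_sym in wu.
    by case/orP: (deg2_neighbours simpG d2 wu vu vw yz) => ->; rewrite ?orbT.
  + by case/orP: (deg2_neighbours simpG dw uv' wu' wv' yz) => ->; rewrite ?orbT.
- by move=> y; rewrite !inE -!orbA => /or3P[]/eqP->.
Qed.

(** No walk from [x] leaves [P], the branching vertices reached from [x] with their nonbranching
    neighbours: a vertex of degree 2 between [c] and [w] is either cut short by an edge from [c] to
    [w] or bypassed. *)
Lemma branching_connected x y : branching x -> branching y ->
  connect (within (@branching G)) x y.
Proof.
move=> bx; set C := connect (within (@branching G)) x.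
pose P v := (branching v /\ C v) \/
            (~~ branching v /\ exists c, [/\ adjacent c v, branching c & C c]).
have step c w : branching c -> C c -> adjacent c w -> P w.
  move=> bc Cc cw; have [bw|nw] := boolP (branching w); [left|right]; split => //.
    by apply: connect_trans Cc (connect1 _); rewrite /within /= cw bc.
  by exists c.
move=> bY; suff : P y by case=> -[] //; rewrite bY.
apply: (@connected_closed G P x conG) => [|v w Pv vw].
  by left; split=> //; apply: connect0.
case: Pv => [[bv Cv]|[nv [c [cv bc Cc]]]]; first exact: step Cv vw.
have [wc|wc] := eqVneq c w; first by left; rewrite -wc.
have [cw|cw] := boolP (adjacent c w); first exact: step Cc cw.
have d2 : deg v = 2.
  have : 1 < deg v by apply/(deg_gt1P simpG); exists c, w; rewrite adjacent_sym.
  by move: nv; rewrite /branching; lia.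
have c' := bypass2 cv vw wc d2 cw; have [_ bw] := within_connect_neq c' wc.
by left; split=> //; apply: connect_trans Cc c'.
Qed.

(** The edges with a branching end form a collapsible set by [line_collapsible]. By
    [nonbranching_edge] every other edge lies in a triangle with two of these, so [collapsible_add]
    absorbs it. *)
Lemma short_branches_supereulerian : supereulerian 0 0 (line_graph G).
Proof.
have [x bx] := heavy_branching heavyG.
have /card_gt0P[e0 _] : 0 < deg x by move: bx; rewrite /branching; lia.
apply: supereulerian_collapsible => [|Z]; first by apply/card_gt0P; exists e0.
rewrite leqn0 cards_eq0 => /eqP->.
set S0 := [set e : edge G | [exists v in ends e, branching v]].
have c0 : @collapsible (line_graph G) (~: set0) S0.
  apply: (line_collapsible bx) => y; first exact: branching_connected.
  by rewrite /branching cards0.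
suff H (r : seq (edge G)) : @collapsible (line_graph G) (~: set0) (S0 :|: [set e in r]).
  have -> : setT = S0 :|: [set e in enum (edge G)]; last exact: H.
  by apply/setP => e; rewrite !inE mem_enum orbT.
elim: r => [|e r IH].
  have -> : S0 :|: [set e in [::]] = S0; last by [].
  by apply/setP => e; rewrite !inE orbF.
have [eS|eS] := boolP (e \in S0 :|: [set f in r]).
  have -> : S0 :|: [set f in e :: r] = S0 :|: [set f in r]; last by [].
  apply/setP => f; rewrite set_cons in_setU in_setU1 in_setU orbCA.
  by case: eqP => // ->; rewrite -in_setU eS.
have -> : S0 :|: [set f in e :: r] = e |: (S0 :|: [set f in r]).
  by rewrite set_cons setUCA.
have [u [v [uv eE]]] := ends_pair e.
have eS0 : e \notin S0 by apply: contra eS => eS; rewrite inE eS.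
have nb a : a \in ends e -> ~~ branching a.
  by move=> ae; apply: contra eS0 => ba; rewrite inE; apply/existsP; exists a; rewrite ae.
have nu : ~~ branching u by apply: nb; rewrite eE set21.
have nv : ~~ branching v by apply: nb; rewrite eE set22.
have [_ _ [w [bw /adjacentP[f1 f1E] /adjacentP[f2 f2E]]]] := nonbranching_edge eE nu nv.
have inS f a b : ends f = [set a; b] -> branching b -> f \in S0.
  by move=> fE bb; rewrite inE; apply/existsP; exists b; rewrite fE set22.
have ef f a : ends f = [set a; w] -> e != f.
  by move=> /inS/(_ bw) fS; apply: contraNneq eS0 => ->.
have /adjacentP[a1 a1E] : @adjacent (line_graph G) e f1.
  by apply: (line_adjacentI (v := u) (ef _ _ f1E)); rewrite ?eE ?f1E set21.
have /adjacentP[a2 a2E] : @adjacent (line_graph G) e f2.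
  by apply: (line_adjacentI (v := v) (ef _ _ f2E)); rewrite ?eE ?f2E ?set21 ?set22.
have f12 : f1 != f2.
  apply/eqP => f12; have : u \in ends f2 by rewrite -f12 f1E set21.
  rewrite f2E !inE (negbTE uv) /= => /eqP uw.
  by move: (ends_neq f1E); rewrite uw eqxx.
apply: (@collapsible_add (line_graph G) _ _ e a1 a2 f1 f2) => //; rewrite ?inE //.
- apply/eqP => a12; have : f1 \in ends a2 by rewrite -a12 a1E set22.
  by rewrite a2E !inE (negbTE f12) orbF eq_sym (negbTE (ef _ _ f1E)).
- by move: (inS _ _ _ f1E bw); rewrite inE => ->.
- by move: (inS _ _ _ f2E bw); rewrite inE => ->.
Qed.

(** There is no such path: the internal vertex [u 2] would have degree at least 3, either by
    adjacency to [u 0] or as an end of the bypass of [u 0], [u 1], [u 2]. This lets the condition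
    for length 2 pass to the next line graph. *)
Lemma branches_bypassed3 : branches_bypassed G 3.
Proof.
move=> u [adj inj d2 _]; exfalso.
have neq i j : i <= 3 -> j <= 3 -> i != j -> u i != u j.
  by move=> ? ? ij; apply: contraNneq ij => /inj->.
have [c|c] := boolP (adjacent (u 0) (u 2)).
  have : 2 < deg (u 2).
    apply: (three_neighbours simpG (x := u 0) (y := u 1) (z := u 3)).
    - by rewrite /= !inE negb_or !neq.
    - by rewrite adjacent_sym.
    - by rewrite adjacent_sym; apply: adj.
    - exact: adj.
  by rewrite d2.
have n02 := neq 0 2 isT isT isT.
have := bypass2 (adj 0 isT) (adj 1 isT) n02 (d2 1 isT) c.
by move/within_connect_neq/(_ n02) => [_]; rewrite /branching d2.
Qed.

Lemma line_deg_gt1 e : 1 < @deg (line_graph G) e.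
Proof.
have [u [v [uv eE]]] := ends_pair e; have := line_deg simpG eE.
have du : 0 < deg u by apply: (@deg_gt0 _ e); rewrite eE set21.
have dv : 0 < deg v by apply: (@deg_gt0 _ e); rewrite eE set22.
have [bu|nu] := boolP (branching u); first by move: bu; rewrite /branching; lia.
have [bv|nv] := boolP (branching v); first by move: bv; rewrite /branching; lia.
by have [-> ->] := nonbranching_edge eE nu nv; lia.
Qed.

(* A vertex of degree 2 of the line graph is then an edge of [G] with both ends of
   degree 2; these lie in triangles with a branching vertex, so no two of them
   are adjacent. *)
Lemma line2_min_deg : (forall v, 1 < deg v) ->
  2 < min_deg (iter_line 2 G).
Proof.
move=> dG; have [e [u [v [eE d5]]]] := heavyG.
have /card_gt0P[a _] : 0 < @deg (line_graph G) e by have := line_deg_gt1 e; lia.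
apply: (@leq_min_deg (iter_line 2 G) _ a) => {}a.
have [f [g [fg aE]]] := @ends_pair (line_graph G) a.
have := line_deg (@line_simple G) aE.
have df := line_deg_gt1 f; have dg := line_deg_gt1 g.
have [f2|] := eqVneq (@deg (line_graph G) f) 2; last first.
  by move=> f2 D; rewrite /iter_line /=; move: D; lia.
have [g2|] := eqVneq (@deg (line_graph G) g) 2; last first.
  by move=> g2 D; rewrite /iter_line /=; move: D; lia.
exfalso; have : @adjacent (line_graph G) f g by apply/adjacentP; exists a.
case/line_adjacentP=> _ [x [xf xg]].
have low h y : h \in [:: f; g] -> y \in ends h -> ~~ branching y.
  move=> hfg yh; have [z _ hE] := endsP yh; have := line_deg simpG hE.
  have -> : @deg (line_graph G) h = 2 by move: hfg; rewrite !inE => /orP[]/eqP->.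
  by have := dG z; rewrite /branching; lia.
have [y xy fE] := endsP xf; have [z xz gE] := endsP xg.
have nx : ~~ branching x by apply: (low f); rewrite ?inE ?eqxx.
have ny : ~~ branching y by apply: (low f); rewrite ?inE ?eqxx // fE set22.
have nz : ~~ branching z by apply: (low g); rewrite ?inE ?eqxx ?orbT // gE set22.
have [dx _ [w [bw xw yw]]] := nonbranching_edge fE nx ny.
have yz : y != z by apply: contraNneq fg => yz; apply/eqP/simpG; rewrite fE gE yz.
have axy : adjacent x y by apply/adjacentP; exists f.
have axz : adjacent x z by apply/adjacentP; exists g.
case/orP: (deg2_neighbours simpG dx yz axy axz xw) => /eqP wE.
  by rewrite wE (negbTE ny) in bw.
by rewrite wE (negbTE nz) in bw.
Qed.

End ShortBranches.

(** * Iterated line graphs and the length [ell] *)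

Lemma iter_line_branches (G : mgraph) n i : simple_graph G -> connected_graph G ->
  heavy_edge G -> branches_bypassed G (n + i).+2 ->
  [/\ simple_graph (iter_line i G), connected_graph (iter_line i G),
      heavy_edge (iter_line i G) & branches_bypassed (iter_line i G) n.+2].
Proof.
move=> simpG conG heavyG; elim: i n => [|i IH] n; first by rewrite addn0.
rewrite addnS -addSn => /IH[simpH conH heavyH bypH]; split.
- exact: line_simple.
- by have [e _] := heavyH; apply: line_connected.
- exact: heavy_line.
- exact: line_branches_bypassed.
Qed.

Lemma divalent_seq_ell (G : mgraph) n u : simple_graph G -> 0 < n ->
  @divalent_seq G n u -> n <= ell G.
Proof.
move=> simpG n0 [adj inj d2 ncl].
have common i : exists e : edge G, i < n -> ends e = [set u i; u i.+1].
  case: (ltnP i n) => [/adj/adjacentP[e]|_]; first by exists e.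
  by have /adjacentP[e] := adj 0 n0; exists e.
have [e eE] := choice common.
pose p k m := [seq (e i, u i.+1) | i <- iota k m].
have w k m : k + m <= n -> walk (u k) (p k m).
  elim: m k => // m IH k km /=; rewrite eE; last by lia.
  by rewrite eqxx IH //; lia.
have verts k m : u k :: unzip2 (p k m) = [seq u i | i <- iota k m.+1].
  by elim: m k => // m IH k; rewrite /= IH.
have bel k m : belast (u k) (unzip2 (p k m)) = [seq u i | i <- iota k m].
  by elim: m k => // m IH k; rewrite /= IH.
have sz : size (p 0 n) == n by rewrite size_map size_iota.
have uni : uniq (walk_verts (u 0) (p 0 n)).
  rewrite /walk_verts verts map_inj_in_uniq ?iota_uniq // => i j.
  by rewrite !mem_iota => ? ?; apply: inj; lia.
have nV : n < #|vert G|.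
  have := max_card (mem (walk_verts (u 0) (p 0 n))).
  by rewrite (card_uniqP uni) /walk_verts verts size_map size_iota.
rewrite /ell; apply: (leq_trans _ (leq_bigmax_cond (Ordinal nV) _)) => //.
apply/existsP; exists (u 0); apply/existsP; exists (Tuple sz) => /=.
apply/and3P; split; first by rewrite /open_path w.
  rewrite /divalent /internal_verts bel; apply/allP => v.
  case: (n) n0 d2 => // m _ d2 /=.
  by case/mapP=> i; rewrite mem_iota => im ->; rewrite d2 //; lia.
apply/negP => /andP[/eqP]; rewrite (eqP sz) => n2.
have := ncl n2; rewrite n2 /p /=; move/negP => na.
case/existsP=> a /existsP[b /existsP[c /existsP[e1 /existsP[e2 /existsP[e3]]]]].
case/and5P=> _ /eqP E1 /eqP E2 /eqP E3.
rewrite /walk_edges /= !inE andbT => /andP[h0 h1]; apply: na.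
have F0 := eE 0 ltac:(lia); have F1 := eE 1 ltac:(lia).
have n02 : u 0 != u 2 by apply/eqP => /inj; lia.
have n01 := ends_neq F0; have n12 := ends_neq F1.
(* In a triangle the ends of one edge are the symmetric difference of the ends of the other two; a
   triangle on [e 0] and [e 1] would thus join [u 0] to [u 2]. *)
have third h h' (k : edge G) : h = e 0 -> h' = e 1 ->
    (forall x, (x \in ends k) = (x \in ends h) (+) (x \in ends h')) ->
    adjacent (u 0) (u 2).
  move=> -> -> K; apply/adjacentP; exists k; apply/setP => x.
  rewrite K F0 F1 !inE; case: (eqVneq x (u 0)) => [->|_] /=.
    by rewrite (negbTE n01) (negbTE n02).
  case: (eqVneq x (u 1)) => [->|_] /=; first by rewrite (negbTE n12).
  by [].
have ne01 : e 0 != e 1.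
  apply/eqP => E; have : u 0 \in ends (e 1) by rewrite -E F0 set21.
  by rewrite F1 !inE (negbTE n01) (negbTE n02).
have ab := ends_neq E1; have bc := ends_neq E2; have ac := ends_neq E3.
have tri x : [/\ (x \in ends e3) = (x \in ends e1) (+) (x \in ends e2),
   (x \in ends e2) = (x \in ends e1) (+) (x \in ends e3) &
   (x \in ends e1) = (x \in ends e2) (+) (x \in ends e3)].
  have E : (x \in ends e3) = (x \in ends e1) (+) (x \in ends e2).
    rewrite E1 E2 E3 !inE; case: (eqVneq x a) => [->|_] /=.
      by rewrite (negbTE ab) (negbTE ac).
    by case: (eqVneq x b) => [->|_] //=; rewrite (negbTE bc).
  by rewrite E; split => //; rewrite ?addKb // addbCA addbb addbF.
case/or3P: h0 => /eqP h0; case/or3P: h1 => /eqP h1; move: ne01; rewrite h0 h1 ?eqxx // => _.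
- by apply: (third _ _ e3 (esym h0) (esym h1)) => x; case: (tri x).
- by apply: (third _ _ e2 (esym h0) (esym h1)) => x; case: (tri x).
- by apply: (third _ _ e3 (esym h0) (esym h1)) => x; rewrite addbC; case: (tri x).
- by apply: (third _ _ e1 (esym h0) (esym h1)) => x; case: (tri x).
- by apply: (third _ _ e2 (esym h0) (esym h1)) => x; rewrite addbC; case: (tri x).
- by apply: (third _ _ e1 (esym h0) (esym h1)) => x; rewrite addbC; case: (tri x).
Qed.

Lemma ell_gt0 (G : mgraph) : simple_graph G -> edge G -> 0 < ell G.
Proof.
move=> simpG e; have [x [y [xy eE]]] := ends_pair e.
apply: (@divalent_seq_ell G 1 (fun i => if i is 0 then x else y)) => //.
split=> //; first by case=> // _; apply/adjacentP; exists e.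
  by case=> [|[|]] // [|[|]] // _ _ E; rewrite E eqxx in xy.
by case.
Qed.

Lemma branches_bypassed_ell (G : mgraph) : simple_graph G ->
  branches_bypassed G (ell G).+1.
Proof. by move=> simpG u /(divalent_seq_ell simpG (ltn0Sn _)); rewrite ltnn. Qed.

Lemma iter_line_short_branches (G : mgraph) : simple_graph G -> connected_graph G ->
  heavy_edge G -> let H := iter_line (ell G).-1 G in
  [/\ simple_graph H, connected_graph H, heavy_edge H & branches_bypassed H 2].
Proof.
move=> simpG conG heavyG; apply: iter_line_branches => //.
have [e _] := heavyG; rewrite add0n prednK ?ell_gt0 //.
exact: branches_bypassed_ell.
Qed.

Lemma ell_supereulerian (G : mgraph) : simple_graph G -> connected_graph G ->
  heavy_edge G -> supereulerian 0 0 (iter_line (ell G) G).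
Proof.
move=> simpG conG heavyG; have [e _] := heavyG.
rewrite -(prednK (ell_gt0 simpG e)).
have [simpH conH heavyH bypH] := iter_line_short_branches simpG conG heavyG.
exact: short_branches_supereulerian.
Qed.

Lemma iter_line_min_deg_gt2 (G : mgraph) : simple_graph G -> connected_graph G ->
  heavy_edge G -> exists i, 2 < min_deg (iter_line i G).
Proof.
(* After [(ell G).-1] line graphs the branches are short; one more gives minimum degree at least 2
   and keeps them short, and [line2_min_deg] takes the other two. *)
move=> simpG conG heavyG; exists (ell G).-1.+3.
have [simpH conH heavyH bypH] := iter_line_short_branches simpG conG heavyG.
set H := iter_line _ G in simpH conH heavyH bypH.
apply: (@line2_min_deg (line_graph H)).
- exact: line_simple.
- by have [e _] := heavyH; apply: line_connected.
- exact: heavy_line.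
- by apply: line_branches_bypassed => //; apply: branches_bypassed3.
- exact: line_deg_gt1.
Qed.

(** * Paths, cycles and the claw *)

Lemma inj_surj_bij (T T' : finType) (f : T -> T') :
  injective f -> (forall y, exists x, y = f x) -> bijective f.
Proof.
move=> injf surj; apply: inj_card_bij => //; rewrite -(card_codom injf).
by apply: subset_leq_card; apply/subsetP => y _; have [x ->] := surj y; apply: codom_f.
Qed.

(** Edges of a simple graph are determined by their ends, so a vertex bijection that preserves and
    reflects edges determines the edge map. *)
Lemma simple_graph_iso (G H : mgraph) (f : vert H -> vert G) :
  simple_graph G -> simple_graph H -> injective f -> (forall v, exists x, v = f x) ->
  (forall h : edge H, exists e : edge G, ends e = f @: ends h) ->
  (forall e : edge G, exists h : edge H, ends e = f @: ends h) -> graph_iso G H.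
Proof.
move=> simpG simpH injf surjf fwd bwd; have [g gE] := choice fwd.
have [f' fK f'K] := inj_surj_bij injf surjf.
have injg : injective g.
  by move=> h h' E; apply/simpH/(imset_inj injf); rewrite -!gE E.
have surjg e : exists h, e = g h.
  by have [h hE] := bwd e; exists h; apply: simpG; rewrite gE.
have [g' gK g'K] := inj_surj_bij injg surjg.
exists f', g'; split; [by exists f|by exists g|move=> e].
rewrite -[e in RHS]g'K gE -imset_comp (eq_imset _ fK).
by rewrite imset_id.
Qed.

Lemma path_simple n : simple_graph (path_graph n).
Proof.
move=> i j /= E; apply: val_inj => /=.
have lt (a b : 'I_n) : [set widen_ord (leqnSn n) a; lift ord0 a] =
    [set widen_ord (leqnSn n) b; lift ord0 b] -> a <= b.
  move=> {}E; have : widen_ord (leqnSn n) b \in [set widen_ord (leqnSn n) a; lift ord0 a].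
    by rewrite E set21.
  by rewrite !inE -!val_eqE /= /bump /=; lia.
by have := lt i j E; have := lt j i (esym E); lia.
Qed.

Lemma cycle_simple n : simple_graph (cycle_graph n.+1).
Proof.
move=> i j /= E; apply: val_inj => /=.
have h1 : i \in [set j; ordS j] by rewrite -E set21.
have h2 : ordS i \in [set j; ordS j] by rewrite -E set22.
have succ m k : k <= m -> k.+1 %% m.+1 = if k == m then 0 else k.+1.
  by rewrite leq_eqVlt => /orP[/eqP->|lt]; rewrite ?eqxx ?modnn // (ltn_eqF lt) modn_small.
have jn : j <= n.+2 by rewrite -ltnS.
move: h1; rewrite !inE => /orP[/eqP->//|/eqP ij]; move: h2.
rewrite !inE ij -!val_eqE /= (succ _ _ jn).
have [jE|jE] := eqVneq (j : nat) n.+2; first by rewrite succ // jE.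
rewrite succ; last by lia.
by case: (eqVneq j.+1 n.+2); lia.
Qed.

Section LightGraphs.

Variable G : mgraph.
Hypotheses (simpG : simple_graph G) (conG : connected_graph G).
Implicit Types (u v w x y z : vert G) (e f : edge G).

Lemma claw_iso v : deg v = 3 -> (forall y, adjacent v y -> deg y = 1) ->
  graph_iso G K13.
Proof.
move=> d3 d1; pose s := enum [set y | adjacent v y].
have ss : size s = 3 by rewrite -cardE -deg_neighbours.
have adjs (i : 'I_3) : adjacent v (nth v s i).
  have : nth v s i \in s by rewrite mem_nth // ss.
  by rewrite mem_enum inE.
have sP y : adjacent v y -> exists i : 'I_3, y = nth v s i.
  move=> vy; have ys : y \in s by rewrite mem_enum inE.
  have lt : index y s < 3 by rewrite -ss index_mem.
  by exists (Ordinal lt); rewrite /= nth_index.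
have back y z : adjacent v y -> adjacent y z -> z = v.
  move=> vy yz; apply/eqP; apply: contraT => ne.
  have : 1 < deg y by apply/(deg_gt1P simpG); exists z, v; rewrite (adjacent_sym y v).
  by rewrite d1.
pose f (o : vert K13) := if o is Some i then nth v s i else v.
have surjf y : exists o, y = f o.
  apply: (@connected_closed G (fun y => exists o, y = f o) v conG); first by exists None.
  move=> a b [[i|] ->] /= ab.
    by exists None; apply: back ab; apply: adjs.
  by have [i ->] := sP b ab; exists (Some i).
apply: (@simple_graph_iso G K13 f) => //.
- move=> i j /= E; have : Some i \in [set None; Some j] by rewrite -E set22.
  by rewrite !inE /= => /eqP[].
- move=> [i|] [j|] //= E.
  + congr Some; apply: val_inj; apply/eqP; move/eqP: E.
    by rewrite nth_uniq ?ss ?enum_uniq.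
  + by have := adjacent_neq (adjs i); rewrite E eqxx.
  + by have := adjacent_neq (adjs j); rewrite -E eqxx.
- move=> i; have /adjacentP[e eE] := adjs i; exists e.
  by rewrite eE /= imsetU1 imset_set1.
- move=> e; have [a [b [_ eE]]] := ends_pair e.
  have ab : adjacent a b by apply/adjacentP; exists e.
  suff [i iE] : exists i : 'I_3, [set a; b] = [set v; nth v s i].
    by exists i; rewrite eE iE /= imsetU1 imset_set1.
  have [[i|] /= aE] := surjf a.
    have va : adjacent v a by rewrite aE.
    by exists i; rewrite (back a b va ab) setUC aE.
  by rewrite aE in ab *; have [i ->] := sP b ab; exists i.
Qed.

Lemma longest_path : exists x p, [/\ path (@adjacent G) x p, uniq (x :: p) &
  forall y q, path (@adjacent G) y q -> uniq (y :: q) -> size q <= size p].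
Proof.
have [/card_gt0P[x0 _] _] := conG.
pose P n := `[< exists x p, [/\ path (@adjacent G) x p, uniq (x :: p) & size p = n] >].
have exP : exists n, P n by exists 0; apply/asboolP; exists x0, [::].
have bP n : P n -> n <= #|vert G|.
  move=> /asboolP[x [p [_ U <-]]]; apply: ltnW.
  by have /= <- := card_uniqP U; apply: max_card.
case: (ex_maxnP exP bP) => n /asboolP[x [p [px U <-]]] mx.
by exists x, p; split => // y q yq Uq; apply: mx; apply/asboolP; exists y, q.
Qed.

(** A longest path spans [G]: its extremities have no neighbour outside by maximality, its inner
    vertices no third neighbour. The only possible further edge joins the extremities and gives a
    cycle. *)
Lemma path_or_cycle : (forall v, deg v <= 2) ->
  (exists n, graph_iso G (path_graph n)) \/ (exists n, graph_iso G (cycle_graph n)).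
Proof.
move=> d2; have [x [p [px U mx]]] := longest_path.
set n := size p; pose u i := nth x (x :: p) i.
have adj i : i < n -> adjacent (u i) (u i.+1) by move/(pathP x): px => /(_ i).
have inj i j : i <= n -> j <= n -> u i = u j -> i = j.
  by move=> li lj /eqP; rewrite /u nth_uniq // => /eqP.
have uP y : y \in x :: p -> exists2 i, i <= n & y = u i.
  move=> yp; exists (index y (x :: p)); last by rewrite /u nth_index.
  by rewrite -ltnS -[n.+1]/(size (x :: p)) index_mem.
have no3 a y1 y2 y3 : uniq [:: y1; y2; y3] -> adjacent a y1 -> adjacent a y2 ->
    adjacent a y3 -> False.
  by move=> Uy h1 h2 h3; have := three_neighbours simpG Uy h1 h2 h3; have := d2 a; lia.
have neq i j : i <= n -> j <= n -> i != j -> u i != u j.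
  by move=> ? ? ij; apply: contraNneq ij => /inj->.
have adjp i : 0 < i <= n -> adjacent (u i) (u i.-1).
  by case: i => // i lt; rewrite adjacent_sym; apply: adj.
have cl y z : y \in x :: p -> adjacent y z -> z \in x :: p.
  move=> /uP[i li ->] iz; apply: contraT => zp.
  have zu j : j <= n -> z != u j.
    by move=> lj; apply: contraNneq zp => ->; rewrite mem_nth.
  have [i0|i0] := posnP i.
    have := mx z (x :: p); rewrite /= i0 in iz *.
    rewrite adjacent_sym iz px /= => /(_ isT); rewrite zp -/(uniq (x :: p)) U.
    by move=> /(_ isT); rewrite ltnn.
  have [ltn|ge] := ltnP i n.
    case: (@no3 (u i) z (u i.-1) (u i.+1)) => //.
    - by rewrite /= !inE negb_or !zu ?neq //; lia.
    - by apply: adjp; lia.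
    - exact: adj.
  have iE : i = n by lia.
  have Uz : uniq (x :: rcons p z) by rewrite -rcons_cons rcons_uniq zp U.
  have pz : path (@adjacent G) x (rcons p z).
    rewrite rcons_path px (last_nth x) -[_ (nth _ _ _) z]/(adjacent (u n) z).
    by rewrite -iE.
  by have := mx x (rcons p z) pz Uz; rewrite size_rcons ltnn.
have surj y : exists2 i, i <= n & y = u i.
  apply: uP; apply: (@connected_closed G (fun y => y \in x :: p) x conG).
    exact: mem_head.
  exact: cl.
have chord i j : i < j <= n -> adjacent (u i) (u j) -> j = i.+1 \/ i = 0 /\ j = n.
  move=> ij uij; case: (eqVneq j i.+1) => [|ji]; [by left|right].
  have [i0|i0] := posnP i; last first.
    case: (@no3 (u i) (u i.-1) (u i.+1) (u j)) => //.
    - by rewrite /= !inE negb_or !neq //; lia.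
    - by apply: adjp; lia.
    - by apply: adj; lia.
  have [jn|jn] := ltnP j n; last by lia.
  case: (@no3 (u j) (u j.-1) (u j.+1) (u i)) => //.
  - by rewrite /= !inE negb_or !neq //; lia.
  - by apply: adjp; lia.
  - by apply: adj; lia.
  - by rewrite adjacent_sym.
have edgeE e : exists i j, [/\ i < j <= n, adjacent (u i) (u j) & ends e = [set u i; u j]].
  have [a [b [ab eE]]] := ends_pair e; have [i li aE] := surj a; have [j lj bE] := surj b.
  have aab : adjacent (u i) (u j) by apply/adjacentP; exists e; rewrite eE aE bE.
  rewrite eE aE bE; case: (ltngtP i j) => ij; first by exists i, j; rewrite ij.
    by exists j, i; rewrite ij setUC adjacent_sym.
  by move: ab; rewrite aE bE ij eqxx.
have [/andP[n1 a0n]|nc] := boolP ((1 < n) && adjacent (u 0) (u n)).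
  (* The path has [n.+1 = m.+3] vertices, as many as [cycle_graph m.+1]. *)
  have [m nE] : exists m, n = m.+2 by exists n.-2; lia.
  right; exists m.+1.
  apply: (@simple_graph_iso G (cycle_graph m.+1) (fun i : 'I_m.+3 => u i)) => //.
  - exact: cycle_simple.
  - by move=> i j /inj E; apply: val_inj; apply: E; rewrite nE -ltnS.
  - by move=> v; have [i li ->] := surj v; rewrite nE -ltnS in li; exists (Ordinal li).
  - move=> i; have := ltn_ord i; rewrite ltnS leq_eqVlt => /orP[/eqP iE|lt].
      have /adjacentP[e eE] := a0n; exists e.
      by rewrite eE /= imsetU1 imset_set1 /= iE modnn nE setUC.
    have /adjacentP[e eE] := adj i ltac:(lia); exists e.
    by rewrite eE /= imsetU1 imset_set1 /= modn_small.
  - move=> e; have [i [j [ij uij ->]]] := edgeE e; have lti : i < m.+3 by lia.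
    case: (chord i j ij uij) => [jE|[i0 jn]].
      exists (Ordinal lti); rewrite /= imsetU1 imset_set1 /= modn_small; last by lia.
      by rewrite jE.
    exists ord_max; rewrite /= imsetU1 imset_set1 /= modnn setUC.
    by rewrite i0 jn nE.
left; exists n.
apply: (@simple_graph_iso G (path_graph n) (fun i : 'I_n.+1 => u i)) => //.
- exact: path_simple.
- by move=> i j /inj E; apply: val_inj; apply: E; rewrite -ltnS.
- by move=> v; have [i li ->] := surj v; rewrite -ltnS in li; exists (Ordinal li).
- move=> i; have /adjacentP[e eE] := adj i (ltn_ord i); exists e.
  by rewrite eE /= imsetU1 imset_set1.
- move=> e; have [i [j [ij uij ->]]] := edgeE e; have lti : i < n by lia.
  exists (Ordinal lti); rewrite /= imsetU1 imset_set1 /= /bump /= add1n.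
  case: (chord i j ij uij) => [->//|[i0 jn]].
  move: nc; rewrite -i0 -jn uij andbT -leqNgt => j1.
  by have -> : j = i.+1 by lia.
Qed.

(** If the end degrees of every edge sum to at most 4, no degree exceeds 3, and a vertex of degree 3
    has only neighbours of degree 1, which gives the claw. Without such a vertex [path_or_cycle]
    applies. *)
Lemma family_heavy_edge : in_family G -> heavy_edge G.
Proof.
move=> [_ np nc [nk _ _]]; apply: contrapT => nh.
have light u v : adjacent u v -> deg u + deg v <= 4.
  by case/adjacentP=> e eE; rewrite leqNgt; apply/negP => d5; apply: nh; exists e, u, v.
have d3 v : deg v <= 3.
  rewrite leqNgt; apply/negP => d4.
  have [y vy _] := @another_neighbour G simpG v v (leq_trans (isT : 1 < 4) d4).
  have := light v y vy; have := @deg_adjacent G y v; rewrite adjacent_sym => /(_ vy).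
  by lia.
have [d2|/existsNP[v]] := pselect (forall v, deg v <= 2).
  by case: (path_or_cycle d2) => -[n]; [apply: np|apply: nc].
move=> d2; apply: nk; apply: (@claw_iso v); first by have := d3 v; lia.
move=> y vy; have := light v y vy; have := @deg_adjacent G y v.
by rewrite adjacent_sym => /(_ vy); lia.
Qed.

End LightGraphs.

(** * The index *)

Lemma st_index_le (G : mgraph) s t i (b : int) :
  supereulerian s t (iter_line i G) -> (i%:Z <= b)%R -> (st_index s t G <= b%:E)%E.
Proof.
move=> sup ib; rewrite /st_index /least; case: pselect => [ex|[]]; last first.
  by exists i; apply/asboolP.
case: ex_minnP => j _ /(_ i); rewrite lee_fin => ji.
by apply: le_trans ib; rewrite lez_nat; apply: ji; apply/asboolP.
Qed.

Lemma d_tilde_min_deg (G : mgraph) : (exists i, 2 < min_deg (iter_line i G)) ->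
  2 < min_deg (iter_line (d_tilde G) G).
Proof.
move=> [i di]; rewrite /d_tilde /least; case: pselect => [ex|[]]; last first.
  by exists i; apply/asboolP.
by case: ex_minnP => j /asboolP.
Qed.

Lemma iter_line_connected (G : mgraph) i : simple_graph G -> connected_graph G ->
  heavy_edge G -> connected_graph (iter_line i G).
Proof.
move=> simpG conG heavyG.
suff [] : connected_graph (iter_line i G) /\ heavy_edge (iter_line i G) by [].
elim: i => // i [conH heavyH]; split; last first.
  by apply: heavy_line => //; apply: iter_line_simple.
by have [e _] := heavyH; apply: line_connected.
Qed.

(** For [x >= 1] the logarithm is nonnegative, so its ceiling is a natural number and can count line
    graph steps. *)
Lemma ceil_log2_spec (R : realType) (x : R) : (1 <= x)%R ->
  exists r : nat, ceil_log2 x = r%:Z%R /\ (x <= 2 ^+ r)%R.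
Proof.
move=> x1; have ln2 : (0 < ln 2 :> R)%R by rewrite ln_gt0 // ltr1n.
have c0 : (0 <= ceil_log2 x)%R.
  rewrite /ceil_log2 ceil_ge0; apply: lt_le_trans (ltrN10 R) _.
  apply: divr_ge0; [exact: ln_ge0|exact: ltW].
have x0 : (0 < x)%R by apply: lt_le_trans x1.
move: c0; case E : (ceil_log2 x) => [r|//] _; exists r; split => //.
have : (ln x / ln 2 <= r%:R)%R.
  by have := Num.Theory.ceil_ge (ln x / ln 2)%R; rewrite -/(ceil_log2 x) E.
rewrite ler_pdivrMr // mulr_natl -lnXn // ler_ln ?posrE ?exprn_gt0 //.
Qed.

Theorem theorem1p4 (R : realType) (G : mgraph) (s t : nat) :
  in_family G -> simple_graph G ->
  let delta : nat := min_deg G in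
  let bound : int :=
    if (delta <= 2) && (s == 0) && (t == 0) then ((ell G)%:Z)%R
    else if (delta <= 2) && (1 <= s + t) then
      ((d_tilde G)%:Z + 1 + ceil_log2 ((s + t + 1)%N%:R : R))%R
    else if (3 <= delta) && (delta <= s + t + 2) then
      (1 + ceil_log2 ((s + t + 1)%N%:R / (delta%:R - 2) : R))%R
    else 1%Z in
  is_true (st_index s t G <= bound%:E)%E.
Proof.
move=> famG simpG delta bound.
have conG : connected_graph G by case: famG.
have heavyG := family_heavy_edge simpG conG famG.
rewrite /bound; case: ifP => [/andP[/andP[_ /eqP->] /eqP->]|ns].
  exact: st_index_le (ell_supereulerian simpG conG heavyG) (lexx _).
case: ifP => [_|st].
  have dH := d_tilde_min_deg (iter_line_min_deg_gt2 simpG conG heavyG).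
  have [|r [-> str]] := @ceil_log2_spec R (s + t + 1)%:R; first by rewrite ler1n addn1.
  have simpH : simple_graph (iter_line (d_tilde G) G) := iter_line_simple simpG.
  have conH : connected_graph (iter_line (d_tilde G) G) by apply: iter_line_connected.
  (* After [d_tilde G] line graphs the minimum degree is at least 3, so its excess over 2, the
     factor in [iter_line_supereulerian], is at least 1. *)
  apply: (@st_index_le _ _ _ (r.+1 + d_tilde G)); last by lia.
  rewrite /iter_line iterD; apply: iter_line_supereulerian => //.
  move: str; rewrite -natrX ler_nat => str.
  by rewrite (leq_trans str) // leq_pmulr // subn_gt0.
have d3 : 2 < delta.
  by rewrite ltnNge; apply/negP => d2; move: ns st; rewrite d2 /=; lia.
case: ifP => [/andP[_ dst]|dst].
  have d2 : (0 < delta%:R - 2 :> R)%R by rewrite subr_gt0 (ltr_nat R 2).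
  have dE : (delta%:R - 2 = (delta - 2)%:R :> R)%R by rewrite natrB // ltnW.
  have [|r [-> str]] := @ceil_log2_spec R ((s + t + 1)%:R / (delta%:R - 2))%R.
    by rewrite ler_pdivlMr // mul1r dE ler_nat; lia.
  apply: (@st_index_le _ _ _ r.+1); last by lia.
  apply: iter_line_supereulerian => //.
  by move: str; rewrite ler_pdivrMr // dE -natrX -natrM ler_nat.
(* What remains is [delta >= s + t + 3], where one line graph suffices. *)
apply: (@st_index_le _ _ _ 1) => //.
by apply: line_supereulerian => //; move: dst d3; rewrite -/delta => /negbT; lia.
Qed.
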